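(* Let $P^1,P^2$ be irreducible transition matrices on a common finite state space $\Sigma$ with the same invariant distribution $\pi$ and respective mixing times $T^1,T^2$; let $\nu^1,\nu^2$ be probability distributions on $\Sigma$ and $\mu$ a measure on $\Sigma$ with full support. There exists a probability space $(\Omega,\mathcal F,\mathbb Q)$ on which one can define Markov chains $Z^1,Z^2$ with transition matrices $P^1,P^2$ and initial distributions $\nu^1,\nu^2$ such that for every $\varepsilon$ with $$0<\varepsilon\le\frac12\wedge\min_{i=1,2}\min_{z\in\Sigma}\frac{\mathrm{Var}_\pi\rho^i_z}{2\|\rho^i_z\|_\infty g(z)}$$ and every $n\ge 2k(\varepsilon)(T^1\vee T^2)$, $$\mathbb Q[\tilde{\mathcal G}(n,\varepsilon)^c]\le C\sum_{i=1,2}\sum_{z\in\Sigma}\Big(e^{-cn\varepsilon^2}+e^{-cn\varepsilon\frac{\pi(z)}{\nu^i(z)}}+\exp\Big\{-\frac{c\,\varepsilon^2g(z)^2}{\mathrm{Var}_\pi\rho^i_z}\,\frac{n}{k(\varepsilon)T^i}\Big\}\Big),$$ where $c,C\in(0,\infty)$ are absolute constants, $$\tilde{\mathcal G}(n,\varepsilon)=\big\{\{Z^1_i\}_{i=1}^{n(1-\varepsilon)}\subset\{Z^2_i\}_{i=1}^n\subset\{Z^1_i\}_{i=1}^{n(1+\varepsilon)}\big\},$$ and $k(\varepsilon)=-\min_{i=1,2}\min_{z\in\Sigma}\log_2\frac{\pi_\star\varepsilon^2g(z)^2}{6\,\mathrm{Var}_\pi(\rho^i_z)}$.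
   Context: The mixing time of a transition matrix $P$ with invariant distribution $\pi$ is $T=\min\{n\ge0:\max_{x\in\Sigma}\|P^n(x,\cdot)-\pi\|_{TV}\le1/4\}$, with $\|\nu-\nu'\|_{TV}=\frac12\sum_x|\nu(x)-\nu'(x)|$. $\pi_\star=\min_z\pi(z)$, $g(x)=\pi(x)/\mu(x)$, $\rho^i(x,y)=p^i(x,y)/\mu(y)$, and $\rho^i_y$ is the function $x\mapsto\rho^i(x,y)$. $\pi(f)=\sum_x\pi(x)f(x)$, $\mathrm{Var}_\pi f=\pi((f-\pi(f))^2)$. Upper summation indices $n(1\pm\varepsilon)$ are understood as integer parts. *)

(* Defs.v *)
From Stdlib Require Import Reals.
From mathcomp Require Import all_boot.
Set Implicit Arguments. Unset Strict Implicit. Unset Printing Implicit Defensive.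
Local Open Scope R_scope.

Definition sumR {T : finType} (f : T -> R) : R := \big[Rplus/0]_(x : T) f x.
Definition prodR_range (m : nat) (f : nat -> R) : R :=
  \big[Rmult/1]_(0 <= i < m) f i.
Definition maxR {T : finType} (f : T -> R) : R :=
  match enum T with [::] => 0 | x :: s => foldr Rmax (f x) (map f s) end.
Definition minR {T : finType} (f : T -> R) : R :=
  match enum T with [::] => 0 | x :: s => foldr Rmin (f x) (map f s) end.

Definition log2 (x : R) : R := ln x / ln 2.
Definition floorN (x : R) : nat := Z.to_nat (Int_part x).

Section Chains.
Variable Sg : finType.

Definition is_distribution (nu : Sg -> R) : Prop :=
  (forall x, 0 <= nu x) /\ sumR nu = 1.

Definition is_transition_matrix (P : Sg -> Sg -> R) : Prop :=
  (forall x y, 0 <= P x y) /\ (forall x, sumR (P x) = 1).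

Fixpoint matpow (P : Sg -> Sg -> R) (n : nat) : Sg -> Sg -> R :=
  match n with
  | O => fun x y => if x == y then 1 else 0
  | S n' => fun x y => sumR (fun w => matpow P n' x w * P w y)
  end.

Definition irreducible (P : Sg -> Sg -> R) : Prop :=
  forall x y, exists n, 0 < matpow P n x y.

Definition is_invariant (P : Sg -> Sg -> R) (pi : Sg -> R) : Prop :=
  is_distribution pi /\ forall y, sumR (fun x => pi x * P x y) = pi y.

Definition tv (nu nu' : Sg -> R) : R := / 2 * sumR (fun x => Rabs (nu x - nu' x)).

Definition dmix (P : Sg -> Sg -> R) (pi : Sg -> R) (n : nat) : R :=
  maxR (fun x => tv (matpow P n x) pi).

Definition is_mixing_time (P : Sg -> Sg -> R) (pi : Sg -> R) (T : nat) : Prop :=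
  dmix P pi T <= / 4 /\ (forall m, (m < T)%N -> / 4 < dmix P pi m).

Definition expect (pi f : Sg -> R) : R := sumR (fun x => pi x * f x).
Definition variance (pi f : Sg -> R) : R :=
  expect pi (fun x => (f x - expect pi f) ^ 2).
Definition supnorm (f : Sg -> R) : R := maxR (fun x => Rabs (f x)).
Definition pistar (pi : Sg -> R) : R := minR pi.

Definition gfun (pi mu : Sg -> R) (x : Sg) : R := pi x / mu x.
Definition rho (P : Sg -> Sg -> R) (mu : Sg -> R) (y : Sg) : Sg -> R :=
  fun x => P x y / mu y.
End Chains.

Record prob_space := {
  Omega : Type;
  measurable : (Omega -> Prop) -> Prop;
  Q : (Omega -> Prop) -> R;
  meas_full : measurable (fun _ => True);
  meas_compl : forall A, measurable A -> measurable (fun w => ~ A w);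
  meas_cunion : forall A : nat -> Omega -> Prop,
      (forall n, measurable (A n)) -> measurable (fun w => exists n, A n w);
  Q_full : Q (fun _ => True) = 1;
  Q_nonneg : forall A, measurable A -> 0 <= Q A;
  Q_sigma_additive : forall A : nat -> Omega -> Prop,
      (forall n, measurable (A n)) ->
      (forall n m w, n <> m -> A n w -> A m w -> False) ->
      infinite_sum (fun n => Q (A n)) (Q (fun w => exists n, A n w))
}.
Arguments measurable : clear implicits.
Arguments Q : clear implicits.

Definition is_markov_chain (PS : prob_space) (Sg : finType)
    (Z : nat -> Omega PS -> Sg) (P : Sg -> Sg -> R) (nu : Sg -> R) : Prop :=
  (forall n x, measurable PS (fun w => Z n w = x)) /\
  (forall (m : nat) (x : nat -> Sg),
      Q PS (fun w => forall i, (i <= m)%N -> Z i w = x i)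
      = nu (x 0%N) * prodR_range m (fun i => P (x i) (x i.+1))).

(* set of values visited in the first m steps (paper: {Z_i}_{i=1}^m;
   here the paper's time i is time i-1) *)
Definition visited {T : Type} {Sg : finType} (Z : nat -> T -> Sg) (m : nat) (w : T)
  (x : Sg) : Prop := exists i, (i < m)%N /\ Z i w = x.

Definition Gtilde {T : Type} {Sg : finType} (Z1 Z2 : nat -> T -> Sg)
    (n : nat) (eps : R) (w : T) : Prop :=
  (forall x, visited Z1 (floorN (INR n * (1 - eps))) w x -> visited Z2 n w x) /\
  (forall x, visited Z2 n w x -> visited Z1 (floorN (INR n * (1 + eps))) w x).

Definition eps_thr (Sg : finType) (P : Sg -> Sg -> R) (pi mu : Sg -> R) : R :=
  minR (fun z => variance pi (rho P mu z) /
                 (2 * supnorm (rho P mu z) * gfun pi mu z)).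

Definition klog (Sg : finType) (P : Sg -> Sg -> R) (pi mu : Sg -> R) (eps : R) : R :=
  minR (fun z => log2 (pistar pi * eps ^ 2 * gfun pi mu z ^ 2 /
                       (6 * variance pi (rho P mu z)))).

Definition kfun (Sg : finType) (P1 P2 : Sg -> Sg -> R) (pi mu : Sg -> R) (eps : R) : R :=
  - Rmin (klog P1 pi mu eps) (klog P2 pi mu eps).

Definition init_term (c : R) (n : nat) (eps piz nuz : R) : R :=
  if Req_EM_T nuz 0 then 0 else exp (- (c * INR n * eps * piz / nuz)).

Definition chain_terms (Sg : finType) (c : R) (n : nat) (eps k : R)
    (P : Sg -> Sg -> R) (pi mu nu : Sg -> R) (T : nat) : R :=
  sumR (fun z =>
    exp (- (c * INR n * eps ^ 2))
    + init_term c n eps (pi z) (nu z)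
    + exp (- (c * eps ^ 2 * gfun pi mu z ^ 2 / variance pi (rho P mu z)
              * (INR n / (k * INR T))))).

(* Main.v *)
(** Both chains read a common field of independent random bits, a stack of bits for each
    state.  A chain at [x] proposes [y] with probability [P x y] and reads the next unread
    bit of the stack of [y]; it jumps to [y] when that bit, of mean [q], is set.  Whatever
    the bits, the cells read along a fixed sequence of proposals are distinct, so each
    chain alone has its prescribed law, with independent geometric holding times.  The set
    of states visited by a chain is the set of stacks in which it has read a set bit; hence
    it is contained in the range of the other chain as soon as it has consumed fewer bits
    of every stack.  As [q] tends to [0] the number of bits consumed, times [q], becomes the
    soft local time [sum_i xi_i P(Z_(i-1), z)] of Popov and Teixeira, with [xi_i]
    exponential of mean one.  Instead of constructing the limiting Poisson process, the
    joint laws of finite trajectories are passed to the limit along an ultrafilter and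
    realised on [[0,1)] with Lebesgue measure by nested intervals.

    The soft local times are then controlled by Chernoff bounds.  Along a chain,
    [1/(1-v) <= exp(v+v^2)] reduces the moment generating function to an exponential
    functional of the path; Jensen's inequality splits it over the residue classes of time
    modulo [b = K T], and within a class consecutive samples are nearly independent draws
    from [pi], since [2 (1/2)^K <= eps pi_star/12].  When one of the exponents of the
    claimed bound is small the claim is trivial, and otherwise the first [b] steps and all
    rounding errors are negligible compared with [n eps pi(z)]. *)
From Stdlib Require Import Reals.
From Stdlib Require Lra.
From mathcomp Require Import all_boot all_order all_algebra.
From mathcomp Require Import Rstruct Rstruct_topology.
From mathcomp Require Import all_classical all_reals all_analysis.
From mathcomp Require Import ring lra zify.
Set Implicit Arguments. Unset Strict Implicit. Unset Printing Implicit Defensive.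
Import Order.TTheory GRing.Theory Num.Theory.
Import numFieldNormedType.Exports.
Require Import Defs.
Local Open Scope ring_scope.
Local Open Scope classical_set_scope.

(** * Exploration of a common field of bits *)

Section Exploration.
Variables (R : realFieldType) (T : finType).
Implicit Types (p : option T -> T -> R) (B : T -> nat -> bool) (c : T -> nat).

Definition bump_at c (y : T) : T -> nat := fun z => ((y == z) + c z)%N.

Fixpoint read_bits B c (ys : seq T) : seq bool :=
  if ys is y :: ys' then B y (c y) :: read_bits B (bump_at c y) ys' else [::].

(** The field [B] is frozen and only the proposals are random. The position [None] precedes the
    first jump, so [p None] is the initial law; [F] receives the proposals together with the bits
    they read. *)
Fixpoint Eread p B n c (x : option T) (F : seq T -> seq bool -> R) : R :=
  if n is n'.+1 then
    \sum_y p x y * Eread p B n' (bump_at c y) (if B y (c y) then Some y else x)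
                     (fun ys bs => F (y :: ys) (B y (c y) :: bs))
  else F [::] [::].

Definition stochastic p := (forall x y, 0 <= p x y) /\ (forall x, \sum_y p x y = 1).

Lemma Eread_le p B n c x F G : stochastic p ->
  (forall ys, size ys = n -> F ys (read_bits B c ys) <= G ys (read_bits B c ys)) ->
  Eread p B n c x F <= Eread p B n c x G.
Proof.
move=> [p0 p1]; elim: n c x F G => [|n IH] c x F G FG /=; first exact: (FG [::]).
apply: ler_sum => y _; apply: ler_wpM2l => //; apply: IH => ys sys.
by have /= := FG (y :: ys); apply; rewrite sys.
Qed.

Lemma Eread_cst p B n c x a : stochastic p -> Eread p B n c x (fun _ _ => a) = a.
Proof.
move=> [p0 p1]; elim: n c x => [|n IH] c x //=.
by under eq_bigr do rewrite IH; rewrite -mulr_suml p1 mul1r.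
Qed.

Lemma Eread_sum p B n c x (I : Type) (r : seq I) (P : pred I) F :
  Eread p B n c x (fun ys bs => \sum_(i <- r | P i) F i ys bs) =
  \sum_(i <- r | P i) Eread p B n c x (F i).
Proof.
elim: n c x F => [|n IH] c x F //=.
by rewrite exchange_big; apply: eq_bigr => y _; rewrite IH mulr_sumr.
Qed.

Lemma eq_Eread p B n c x F G : (forall ys bs, F ys bs = G ys bs) ->
  Eread p B n c x F = Eread p B n c x G.
Proof.
elim: n c x F G => [|n IH] c x F G FG //=.
by apply: eq_bigr => y _; congr (_ * _); apply: IH.
Qed.

(** Counters only grow, so cells below [c] are never read again. *)
Lemma Eread_bits p B B' n c x F :
  (forall z k, (c z <= k)%N -> B z k = B' z k) ->
  Eread p B n c x F = Eread p B' n c x F.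
Proof.
elim: n c x F => [|n IH] c x F BB //=.
apply: eq_bigr => y _; rewrite (BB y (c y)) //; congr (_ * _); apply: IH => z k.
by move=> ck; apply: BB; apply: leq_trans ck; rewrite leq_addl.
Qed.

(** Number of bits of the stack of [z] read up to and including the [m]-th accepted proposal; a
    rejection leaves [m] unchanged. *)
Fixpoint consumed (z : T) m (ys : seq T) (bs : seq bool) : nat :=
  match m, ys, bs with
  | m'.+1, y :: ys', b :: bs' => ((y == z) + consumed z (if b then m' else m) ys' bs')%N
  | _, _, _ => 0%N
  end.

(** Masking the proposals by the bits read leaves the trajectory. The stack of [z] is read in order
    and without gaps, so a visit to [z] is a set bit in the segment consumed; ranges can then be
    compared through these counts. *)
Lemma mem_take_mask B c z m ys :
  (z \in take m (mask (read_bits B c ys) ys)) =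
  has (B z) (iota (c z) (consumed z m ys (read_bits B c ys))).
Proof.
elim: ys m c => [|y ys IH] [|m] c //=; first by rewrite take0.
have -> : (z \in take m.+1 (mask (B y (c y) :: read_bits B (bump_at c y) ys) (y :: ys)))
  = ((y == z) && B z (c z)) ||
    (z \in take (if B y (c y) then m else m.+1) (mask (read_bits B (bump_at c y) ys) ys)).
  rewrite /=; case: eqP => [<-|/eqP yz].
    by case: (B y (c y)) => //=; rewrite inE eqxx.
  by case: (B y (c y)) => //=; rewrite inE eq_sym (negbTE yz).
rewrite IH /bump_at; case: eqP => [->|_] /=; last by rewrite !add0n.
by rewrite add1n.
Qed.

Variable q : R.

(** The same exploration when every proposal draws a fresh bit of mean [q]. *)
Fixpoint Elaw p n (x : option T) (F : seq T -> seq bool -> R) : R :=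
  if n is n'.+1 then
    \sum_y p x y *
      (q * Elaw p n' (Some y) (fun ys bs => F (y :: ys) (true :: bs)) +
       (1 - q) * Elaw p n' x (fun ys bs => F (y :: ys) (false :: bs)))
  else F [::] [::].

(** * Averages over a finite field of independent bits *)

Section Average.
Variable N : nat.
Let cell := (T * 'I_N)%type.
Let field := {ffun cell -> bool}.

(** Truncating each stack to [N] cells makes the field finite; the default [false] is never read
    while the counters stay below [N]. *)
Definition lookup (f : field) (z : T) (k : nat) : bool :=
  if insub k is Some i then f (z, i) else false.

Definition bit_weight (b : bool) : R := if b then q else 1 - q.

Definition average (G : (T -> nat -> bool) -> R) : R :=
  \sum_(f : field) (\prod_d bit_weight (f d)) * G (lookup f).

Let flip (d : cell) (f : field) : field := [ffun d' => (d' == d) (+) f d'].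

Let flipK d : involutive (flip d).
Proof. by move=> f; apply/ffunP => d'; rewrite !ffunE addbA addbb. Qed.

Let weight_flip (d : cell) (f : field) : f d ->
  (1 - q) * \prod_d' bit_weight (f d') = q * \prod_d' bit_weight (flip d f d').
Proof.
move=> fd; rewrite (bigD1 d) //= [in RHS](bigD1 d) //= !ffunE eqxx fd /=.
have -> : \prod_(i | i != d) bit_weight (flip d f i) = \prod_(i | i != d) bit_weight (f i).
  by apply: eq_bigr => i /negbTE id; rewrite ffunE id.
by rewrite /bit_weight; ring.
Qed.

(** Flipping [d] is an involution that exchanges the two values of this bit and keeps every other
    factor of the weight, so the bit is independent of any functional that ignores it. *)
Let average_bit1 (d : cell) (G : field -> R) : (forall f, G (flip d f) = G f) ->
  \sum_(f : field | f d) (\prod_d bit_weight (f d)) * G f =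
  q * \sum_(f : field) (\prod_d bit_weight (f d)) * G f.
Proof.
move=> Gd; rewrite (bigID (fun f : field => f d) xpredT) /=.
set S1 := \sum_(f : field | f d) _; set S0 := (X in S1 + X).
suff: (1 - q) * S1 = q * S0 by rewrite mulrDr => <-; ring.
rewrite /S0 (reindex_onto (flip d) (flip d)) /=; last by move=> f _; apply: flipK.
rewrite !mulr_sumr; apply: eq_big => [f|f fd].
  by rewrite flipK eqxx andbT ffunE eqxx /= negbK.
by rewrite Gd !mulrA (weight_flip fd).
Qed.

Let average_bit (d : cell) (G1 G0 : field -> R) :
  (forall f, G1 (flip d f) = G1 f) -> (forall f, G0 (flip d f) = G0 f) ->
  \sum_(f : field) (\prod_d bit_weight (f d)) * (if f d then G1 f else G0 f) =
  q * (\sum_(f : field) (\prod_d bit_weight (f d)) * G1 f) +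
  (1 - q) * \sum_(f : field) (\prod_d bit_weight (f d)) * G0 f.
Proof.
move=> G1d G0d; rewrite (bigID (fun f : field => f d)) /=.
rewrite (eq_bigr (fun f : field => (\prod_d bit_weight (f d)) * G1 f)); last first.
  by move=> f ->.
rewrite average_bit1 //; congr (_ + _).
rewrite (eq_bigr (fun f : field => (\prod_d bit_weight (f d)) * G0 f)); last first.
  by move=> f /negbTE ->.
have E1 := average_bit1 G0d.
have := bigID (fun f : field => f d) xpredT (fun f => (\prod_d bit_weight (f d)) * G0 f)
  : \sum_(f : field) _ = _.
move=> /= E; rewrite {}E1 in E.
by apply/eqP; rewrite mulrBl mul1r eq_sym subr_eq addrC; apply/eqP.
Qed.

(* For a fixed sequence of proposals the cells that are read are pairwise distinct,
   so the bits read are independent whatever the transition rule is. *)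
Lemma average_Eread p n c x F : (forall z, (c z + n <= N)%N) ->
  average (fun B => Eread p B n c x F) = Elaw p n x F.
Proof.
elim: n c x F => [|n IH] c x F cN /=.
  rewrite /average /= -mulr_suml.
  rewrite -(bigA_distr_bigA (fun _ : cell => bit_weight)) /=.
  rewrite big1 ?mul1r // => d _.
  by rewrite big_bool /bit_weight /= addrC subrK.
rewrite /average; under [LHS]eq_bigr => f _ do rewrite mulr_sumr.
rewrite exchange_big /=; apply: eq_bigr => y _.
under eq_bigr => f _ do rewrite mulrCA.
rewrite -mulr_sumr; congr (_ * _).
have cyN : (c y < N)%N by have := cN y; lia.
have bN z : (bump_at c y z + n <= N)%N by have := cN z; rewrite /bump_at; case: eqP; lia.
set d : cell := (y, Ordinal cyN).
have ld f : lookup f y (c y) = f d by rewrite /lookup insubT.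
pose H b f := Eread p (lookup f) n (bump_at c y) (if b then Some y else x)
   (fun ys bs => F (y :: ys) (b :: bs)).
(* The counter of [y] has moved past [d], so the continuation cannot see the flipped bit. *)
have Hd b f : H b (flip d f) = H b f.
  apply: Eread_bits => z k; rewrite /bump_at /lookup; case: insubP => // i _ <-.
  rewrite ffunE; case: ((z, i) =P d) => //= -[zy iy].
  by rewrite iy zy eqxx /= add1n ltnn.
rewrite (eq_bigr (fun f : field => (\prod_d bit_weight (f d)) * (if f d then H true f else H false f))); last first.
  by move=> f _; rewrite ld /H; case: (f d).
rewrite (average_bit (Hd true) (Hd false)).
by congr (_ * _ + _ * _); apply: IH.
Qed.

Hypothesis q01 : 0 <= q <= 1.

Lemma average_le G G' : (forall B, G B <= G' B) -> average G <= average G'.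
Proof.
move=> GG; apply: ler_sum => f _; apply: ler_wpM2l => //.
by apply: prodr_ge0 => d _; rewrite /bit_weight; case: (f d); case/andP: q01; rewrite ?subr_ge0.
Qed.

Lemma eq_average G G' : (forall B, G B = G' B) -> average G = average G'.
Proof. by move=> GG; apply: eq_bigr => f _; rewrite GG. Qed.

Lemma average_sum (I : Type) (r : seq I) (P : pred I) G :
  average (fun B => \sum_(i <- r | P i) G i B) = \sum_(i <- r | P i) average (G i).
Proof.
by rewrite /average; under eq_bigr do rewrite mulr_sumr; rewrite exchange_big.
Qed.

End Average.
End Exploration.

(** * Law of a single exploration *)

Section Law.
Variables (R : realFieldType) (T : finType) (q : R).
Hypothesis q01 : 0 <= q <= 1.
Variable p : option T -> T -> R.
Hypothesis p_stoch : stochastic p.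

Lemma Elaw_le n x F G : (forall ys bs, F ys bs <= G ys bs) ->
  Elaw q p n x F <= Elaw q p n x G.
Proof.
have [q0 q1] := andP q01; elim: n x F G => [|n IH] x F G FG /=; first exact: FG.
apply: ler_sum => y _; apply: ler_wpM2l; first exact: p_stoch.1.
by apply: lerD; apply: ler_wpM2l; rewrite ?subr_ge0 //; apply: IH.
Qed.

Lemma eq_Elaw n x F G : (forall ys bs, F ys bs = G ys bs) ->
  Elaw q p n x F = Elaw q p n x G.
Proof. by move=> FG; apply/eqP; rewrite eq_le !Elaw_le // => ys bs; rewrite FG. Qed.

Lemma Elaw_scale n x a F :
  Elaw q p n x (fun ys bs => a * F ys bs) = a * Elaw q p n x F.
Proof.
elim: n x F => [|n IH] x F //=.
by rewrite mulr_sumr; apply: eq_bigr => y _; rewrite !IH; ring.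
Qed.

Lemma Elaw_add n x F G :
  Elaw q p n x (fun ys bs => F ys bs + G ys bs) = Elaw q p n x F + Elaw q p n x G.
Proof.
elim: n x F G => [|n IH] x F G //=.
by rewrite -big_split; apply: eq_bigr => y _ /=; rewrite !IH; ring.
Qed.

Lemma Elaw_cst n x a : Elaw q p n x (fun _ _ => a) = a.
Proof.
elim: n x => [|n IH] x //=; rewrite -[RHS]mul1r -[in RHS](p_stoch.2 x) mulr_suml.
by apply: eq_bigr => y _; rewrite !IH; ring.
Qed.

Fixpoint path_prob (x : option T) (s : seq T) : R :=
  if s is a :: s' then p x a * path_prob (Some a) s' else 1.

(** Probability that [n] independent bits of mean [q] contain at least [m] set ones. *)
Fixpoint enough (n m : nat) : R :=
  match m, n with
  | 0%N, _ => 1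
  | _.+1, 0%N => 0
  | m'.+1, n'.+1 => q * enough n' m' + (1 - q) * enough n' m
  end.

Lemma Elaw_size n x m :
  Elaw q p n x (fun ys bs => (m <= size (mask bs ys))%:R) = enough n m.
Proof.
elim: n x m => [|n IH] x [|m] //=; first by under eq_bigr => y _ do rewrite !Elaw_cst;
  rewrite -[RHS](p_stoch.2 x); apply: eq_bigr => y _; ring.
under eq_bigr => y _ do rewrite (IH (Some y) m) (IH x m.+1).
by rewrite -mulr_suml p_stoch.2 mul1r.
Qed.

(** Bits are independent of proposals, so the states visited and the number of trials needed
    decouple. *)
Lemma Elaw_prefix n x s :
  Elaw q p n x (fun ys bs => (prefix s (mask bs ys))%:R) = path_prob x s * enough n (size s).
Proof.
elim: n x s => [|n IH] x [|a s] //=; rewrite ?mulr1 ?mulr0 //.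
  under eq_bigr => y _ do rewrite Elaw_cst (IH x [::]) /=.
  rewrite -[RHS](p_stoch.2 x); apply: eq_bigr => y _.
  by case: {IH}n => [|n] /=; ring.
(* After a rejection the whole path remains to be made from the same state; an accepted first
   proposal has to be [a]. *)
have IHf := IH x (a :: s); rewrite [RHS]/= in IHf.
under eq_bigr => y _ do rewrite IHf mulrDr.
rewrite big_split /= -[X in _ + X]mulr_suml p_stoch.2 mul1r.
rewrite (bigD1 a) //= eqxx /= (IH (Some a) s) big1 => [|y /negbTE ya]; first by ring.
rewrite (@eq_Elaw _ _ _ (fun _ _ => 0)) => [|ys bs]; last by rewrite eq_sym ya.
by rewrite Elaw_cst !mulr0.
Qed.

(** Markov's inequality for [2 ^ (- X)], with [X] the number of set bits, whose mean is
    [(1 - q / 2) ^ n]; it is checked along the recursion of [enough]. *)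
Lemma enough_ge n m : 1 - 2 ^+ m * (1 - q / 2) ^+ n <= enough n m.
Proof.
have [q0 q1] := andP q01; elim: n m => [|n IH] [|m] /=.
- by rewrite !expr0 mul1r subrr ler01.
- by rewrite expr0 mulr1 subr_le0 exprn_ege1 // ler1n.
- by rewrite expr0 mul1r gerBl exprn_ge0 //; lra.
rewrite exprS (exprS (1 - q / 2)).
have H1 := IH m; have H2 := IH m.+1; rewrite exprS in H2.
have E1 := ler_wpM2l q0 H1.
have q1' : 0 <= 1 - q by rewrite subr_ge0.
have E2 := ler_wpM2l q1' H2.
set u : R := 2 ^+ m * (1 - q / 2) ^+ n in H1 E1.
have -> : 2 * 2 ^+ m * ((1 - q / 2) * (1 - q / 2) ^+ n) = 2 * (1 - q / 2) * u by rewrite /u; ring.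
have E3 : (1 - q) * (1 - 2 * 2 ^+ m * (1 - q / 2) ^+ n) = (1 - q) * (1 - 2 * u) by rewrite /u; ring.
rewrite E3 in E2; apply: le_trans (lerD E1 E2).
by rewrite le_eqVlt; apply/orP; left; apply/eqP; field.
Qed.

Variable z : T.
Variable th : R.

(* Moment generating function at [th] of the soft local time at [z] when the chain
   has made [m] steps: the holding times are exponential of mean one. *)
Fixpoint mgf (m : nat) (x : option T) : R :=
  if m is m'.+1 then (1 - th * p x z)^-1 * \sum_y p x y * mgf m' (Some y) else 1.

Hypothesis thp : forall x, th * p x z < 1.

Lemma mgf_ge0 m x : 0 <= mgf m x.
Proof.
elim: m x => //= m IH x; apply: mulr_ge0.
  by rewrite invr_ge0 subr_ge0 ltW.
by apply: sumr_ge0 => y _; apply: mulr_ge0 => //; apply: p_stoch.1.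
Qed.

(** The relation between [s] and [th] makes [1 - (1 - q) * (1 + p x z * (s - 1))] equal to
    [q * (1 - th * p x z)], so a geometric holding time contributes exactly the factor of an
    exponential one. The accepted proposal that ends it costs at most [Num.max 1 s]. *)
Lemma Elaw_consumed (s : R) n m x : 0 < q -> q < 1 -> 0 <= s -> (1 - q) * (s - 1) = th * q ->
  Elaw q p n x (fun ys bs => s ^+ consumed z m ys bs * (m <= size (mask bs ys))%:R)
  <= Num.max 1 s ^+ m * mgf m x.
Proof.
move=> q_gt0 q_lt1 s0 sth.
set S := Num.max 1 s; have S1 : 1 <= S by rewrite /S le_max lexx.
have Ss : s <= S by rewrite /S le_max lexx orbT.
have S0 : 0 <= S by apply: le_trans S1.
elim: n m x => [|n IH] [|m] x /=.
- by rewrite !expr0 mul1r.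
- by rewrite mulr0; apply: mulr_ge0; [apply: exprn_ge0|apply: (mgf_ge0 m.+1)].
- under eq_bigr => y _ do rewrite !expr0 !mul1r !Elaw_cst.
  rewrite expr0 mul1r -[leRHS](p_stoch.2 x); apply: ler_sum => y _.
  by rewrite le_eqVlt; apply/orP; left; apply/eqP; ring.
set M := S ^+ m.+1 * mgf m.+1 x.
have M0 : 0 <= M by apply: mulr_ge0; [apply: exprn_ge0|apply: mgf_ge0].
pose a y : R := s ^+ (y == z).
have a0 y : 0 <= a y by apply: exprn_ge0.
have aS y : a y <= S by rewrite /a; case: (y == z).
(* The weight [a y] of an accepted proposal is replaced by [S]; that of a rejected one is kept
   exactly. *)
apply: (@le_trans _ _ (\sum_y p x y * (q * (S ^+ m.+1 * mgf m (Some y)) + (1 - q) * (a y * M)))).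
  apply: ler_sum => y _; apply: ler_wpM2l; first exact: p_stoch.1.
  apply: lerD; (apply: ler_wpM2l; first by rewrite ?subr_ge0 ltW).
  - under eq_Elaw => ys bs do rewrite exprD -mulrA.
    rewrite Elaw_scale exprS -mulrA; apply: ler_pM; [exact: a0| |exact: aS|exact: IH].
    by rewrite -[leLHS](Elaw_cst n (Some y)); apply: Elaw_le => ys bs; rewrite mulr_ge0 // exprn_ge0.
  - under eq_Elaw => ys bs do rewrite exprD -mulrA.
    by rewrite Elaw_scale; apply: ler_wpM2l; [exact: a0|exact: (IH m.+1)].
have ap : \sum_y p x y * a y = 1 + p x z * (s - 1).
  rewrite (bigD1 z) //= /a eqxx expr1 -[X in _ = X + _](p_stoch.2 x) [in RHS](bigD1 z) //=.
  rewrite (eq_bigr (p x)) => [|y /negbTE ->]; last by rewrite expr0 mulr1.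
  by ring.
have d0 : 1 - th * p x z != 0 by rewrite subr_eq0 gt_eqF.
have Mp : M * (1 - th * p x z) = S ^+ m.+1 * \sum_y p x y * mgf m (Some y).
  by rewrite /M /=; field.
rewrite (eq_bigr (fun y => q * (S ^+ m.+1 * (p x y * mgf m (Some y))) + (1 - q) * M * (p x y * a y))); last first.
  by move=> y _; ring.
rewrite big_split /= -!mulr_sumr -Mp ap.
rewrite le_eqVlt; apply/orP; left; apply/eqP.
have -> : (1 - q) * M * (1 + p x z * (s - 1)) = M * ((1 - q) + ((1 - q) * (s - 1)) * p x z) by ring.
by rewrite sth; ring.
Qed.

End Law.

Lemma expr_Bernoulli (R : realFieldType) (x : R) n : 0 <= x <= 1 ->
  (1 - x) ^+ n * (1 + n%:R * x) <= 1.
Proof.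
case/andP=> x0 x1; elim: n => [|n IH]; first by rewrite expr0 mul0r addr0 mul1r.
apply: le_trans IH; rewrite exprSr -mulrA; apply: ler_wpM2l; first by rewrite exprn_ge0 // subr_ge0.
have n0 : 0 <= n%:R :> R by apply: ler0n.
by rewrite -natr1; nra.
Qed.

(** * Two explorations of the same field *)

Section Joint.
Variables (R : realFieldType) (T : finType) (q : R).
Hypothesis q01 : 0 <= q <= 1.
Variables p1 p2 : option T -> T -> R.
Hypotheses (p1_stoch : stochastic p1) (p2_stoch : stochastic p2).
Variable N : nat.
Let c0 : T -> nat := fun=> 0%N.

(** Given the field, the proposals of the two chains are independent. Each chain makes [N]
    proposals, so [N] cells per stack suffice. *)
Definition joint (F : seq T -> seq bool -> seq T -> seq bool -> R) : R :=
  average q N (fun B => Eread p1 B N c0 None (fun y1 b1 =>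
    Eread p2 B N c0 None (fun y2 b2 => F y1 b1 y2 b2))).

(** Only bits read from one common field have to be compared: the coupling enters through this
    restriction. *)
Lemma joint_le F G :
  (forall B y1 y2, let b1 := read_bits B c0 y1 in let b2 := read_bits B c0 y2 in
     F y1 b1 y2 b2 <= G y1 b1 y2 b2) ->
  joint F <= joint G.
Proof.
move=> FG; apply: average_le => // B.
by apply: Eread_le => // y1 _; apply: Eread_le => // y2 _; apply: FG.
Qed.

Lemma eq_joint F G : (forall y1 b1 y2 b2, F y1 b1 y2 b2 = G y1 b1 y2 b2) ->
  joint F = joint G.
Proof.
move=> FG; apply: eq_average => B.
by apply: eq_Eread => y1 b1; apply: eq_Eread => y2 b2.
Qed.

Lemma joint_sum (I : Type) (r : seq I) (P : pred I) F :
  joint (fun y1 b1 y2 b2 => \sum_(i <- r | P i) F i y1 b1 y2 b2) =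
  \sum_(i <- r | P i) joint (F i).
Proof.
rewrite -average_sum; apply: eq_average => B; rewrite -Eread_sum.
by apply: eq_Eread => y1 b1; rewrite Eread_sum.
Qed.

Lemma joint_add F G :
  joint (fun y1 b1 y2 b2 => F y1 b1 y2 b2 + G y1 b1 y2 b2) = joint F + joint G.
Proof.
have := joint_sum [:: true; false] xpredT (fun b : bool => if b then F else G).
rewrite !big_cons big_nil addr0 => <-; apply: eq_joint => y1 b1 y2 b2.
by rewrite !big_cons big_nil addr0.
Qed.

(** The second exploration integrates to one, and what remains is covered by [average_Eread]:
    sharing the field does not alter the marginals. *)
Lemma joint_fst F : joint (fun y1 b1 _ _ => F y1 b1) = Elaw q p1 N None F.
Proof.
rewrite -(@average_Eread _ _ _ N _ _ c0) => [|z]; last by rewrite add0n.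
by apply: eq_average => B; apply: eq_Eread => y1 b1; rewrite Eread_cst.
Qed.

Lemma joint_snd F : joint (fun _ _ y2 b2 => F y2 b2) = Elaw q p2 N None F.
Proof.
rewrite -(@average_Eread _ _ _ N _ _ c0) => [|z]; last by rewrite add0n.
by apply: eq_average => B; rewrite Eread_cst.
Qed.

End Joint.

(** * Realisation of limiting laws *)

Section Cylinder.
Variables (R : realType) (A : finType) (p : seq A -> R) (a0 : A).
Hypothesis p_ge0 : forall s, 0 <= p s.
Hypothesis p_nil : p [::] = 1.
Hypothesis p_rcons : forall s, p s = \sum_a p (rcons s a).

(** A word [s] owns a half-open interval of length [p s]; those of its one-letter extensions lie
    side by side inside it in the order of [enum_rank], and this is the total length of the first
    [k]. *)
Definition cumulative (s : seq A) (k : nat) : R :=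
  \sum_(a : A | (enum_rank a < k)%N) p (rcons s a).

(** Words are reversed so that structural recursion removes the last letter. *)
Fixpoint left_end_rev (rs : seq A) : R :=
  if rs is a :: rs' then left_end_rev rs' + cumulative (rev rs') (enum_rank a) else 0.

Definition left_end s := left_end_rev (rev s).

Lemma left_end_rcons s a : left_end (rcons s a) = left_end s + cumulative s (enum_rank a).
Proof. by rewrite /left_end rev_rcons /= revK. Qed.

Lemma cumulativeS s a :
  cumulative s (enum_rank a).+1 = cumulative s (enum_rank a) + p (rcons s a).
Proof.
rewrite /cumulative (bigD1 a) //= addrC; congr (_ + _); apply: eq_bigl => b.
by rewrite ltnS ltn_neqAle andbC -(inj_eq enum_rank_inj) -val_eqE.
Qed.

Lemma cumulative_le s k l : (k <= l)%N -> cumulative s k <= cumulative s l.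
Proof.
move=> kl; rewrite /cumulative big_mkcond [leRHS]big_mkcond; apply: ler_sum => a _.
by case: ltnP => // ak; [rewrite (leq_trans ak kl)|case: ifP].
Qed.

Lemma cumulative_full s : cumulative s #|A| = p s.
Proof. by rewrite p_rcons; apply: eq_bigl => a; rewrite ltn_ord. Qed.

Definition in_cell (s : seq A) (w : R) : bool := left_end s <= w < left_end s + p s.

Lemma in_cell_rcons s a w : in_cell (rcons s a) w =
  (left_end s + cumulative s (enum_rank a) <= w < left_end s + cumulative s (enum_rank a).+1).
Proof. by rewrite /in_cell left_end_rcons cumulativeS addrA. Qed.

Lemma in_cell_sub s a w : in_cell (rcons s a) w -> in_cell s w.
Proof.
rewrite in_cell_rcons /in_cell => /andP[lw wu]; apply/andP; split.
  apply: le_trans lw; rewrite lerDl; apply: sumr_ge0 => ? _; exact: p_ge0.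
by apply: (lt_le_trans wu); rewrite lerD2l -[leRHS]cumulative_full cumulative_le.
Qed.

Lemma in_cell_inj s a b w : in_cell (rcons s a) w -> in_cell (rcons s b) w -> a = b.
Proof.
rewrite !in_cell_rcons => /andP[la ua] /andP[lb ub].
have le_absurd k l : left_end s + cumulative s l <= w -> w < left_end s + cumulative s k ->
    (k <= l)%N -> False.
  move=> lw wk kl; have := le_lt_trans lw wk.
  by rewrite ltrD2l ltNge cumulative_le.
have [ab|ba|/ord_inj ab] := ltngtP (enum_rank a) (enum_rank b).
- by have := le_absurd _ _ lb ua ab.
- by have := le_absurd _ _ la ub ba.
- exact: (@enum_rank_inj A).
Qed.

(** The letter is the one at which the cumulative length first exceeds the offset of [w]. *)
Lemma in_cell_ex s w : in_cell s w -> exists a, in_cell (rcons s a) w.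
Proof.
move=> /andP[lw wu].
pose P k := w < left_end s + cumulative s k.
have exP : exists k, P k by exists #|A|; rewrite /P cumulative_full.
have [k Pk kmin] := ex_minnP exP.
have kA : (k <= #|A|)%N by apply: kmin; rewrite /P cumulative_full.
case: k => [|k] in Pk kmin kA *.
  by move: Pk; rewrite /P /cumulative big_pred0 // addr0 ltNge lw.
exists (enum_val (Ordinal kA)); rewrite in_cell_rcons enum_valK /= -[_ < _]/(P k.+1) Pk andbT.
by rewrite leNgt; apply/negP => /kmin; rewrite ltnn.
Qed.

(** The default [a0] only serves points outside [[0, 1)]. *)
Fixpoint locate (w : R) (n : nat) : seq A :=
  if n is n'.+1 then
    rcons (locate w n') (odflt a0 [pick a | in_cell (rcons (locate w n') a) w])
  else [::].

Definition coordinate (n : nat) (w : R) : A := last a0 (locate w n.+1).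

Lemma size_locate w n : size (locate w n) = n.
Proof. by elim: n => //= n IH; rewrite size_rcons IH. Qed.

Lemma locateE w n : locate w n = mkseq (coordinate^~ w) n.
Proof.
elim: n => // n IH; rewrite mkseqS -IH /coordinate /= last_rcons //.
Qed.

Lemma in_cell_nil w : in_cell [::] w = (0 <= w < 1).
Proof. by rewrite /in_cell p_nil add0r. Qed.

Lemma in_cell_locate w n : 0 <= w < 1 -> in_cell (locate w n) w.
Proof.
move=> w01; elim: n => [|n IH]; first by rewrite in_cell_nil.
rewrite /=; case: pickP => [//|no]; have [a] := in_cell_ex IH.
by rewrite no.
Qed.

Lemma in_cell_unique w s : in_cell s w -> locate w (size s) = s.
Proof.
elim/last_ind: s => [//|s a IH] sw; rewrite size_rcons /= IH ?(in_cell_sub sw) //.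
case: pickP => [b bw|no] /=; first by rewrite (in_cell_inj bw sw).
by have := no a; rewrite sw.
Qed.

Lemma locate_event s : [set w | locate w (size s) = s] `&` `[0, 1[ =
  `[left_end s, left_end s + p s[.
Proof.
apply/seteqP; split => w /=; rewrite !in_itv /=.
  by move=> [ls w01]; have := in_cell_locate (size s) w01; rewrite ls.
move=> sw; split; first exact: in_cell_unique.
by rewrite -in_cell_nil; elim/last_ind: s sw => // s a IH /in_cell_sub.
Qed.

End Cylinder.

(** * The unit interval as a probability space *)

Section LebesgueSpace.
Variable K : realType.
Local Notation leb := (@lebesgue_measure K).
Let I : set (measurableTypeR K) := `[0, 1[.
Let mI : @measurable_structure.measurable _ (measurableTypeR K) I := measurable_itv _.

(** Events are judged by their trace on [[0, 1)], so the carrier can remain the whole line. *)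
Definition leb_event (E : K -> Prop) : Prop := @measurable_structure.measurable _ (measurableTypeR K) ((E : set (measurableTypeR K)) `&` I).
Definition leb_prob (E : K -> Prop) : K := fine (leb ((E : set (measurableTypeR K)) `&` I)).

Let leb_probE E : leb_event E -> leb (E `&` I) = (leb_prob E)%:E.
Proof.
move=> mE; rewrite /leb_prob fineK // ge0_fin_numE //.
apply: (@le_lt_trans _ _ (leb I)); first by apply: le_measure; rewrite ?inE //; exact: subIsetr.
by rewrite lebesgue_measure_itv /= lte_fin ltr01 ltry.
Qed.

Lemma leb_event_full : leb_event (fun=> True).
Proof. by rewrite /leb_event setTI. Qed.

Lemma leb_event_compl E : leb_event E -> leb_event (fun w => ~ E w).
Proof.
move=> mE; rewrite /leb_event.
have -> : (fun w => ~ E w) `&` I = I `\` (E `&` I).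
  by apply/seteqP; split => w /=; [move=> [nE Iw]; split => // -[]|move=> [Iw nE]; split => // Ew; apply: nE].
exact: measurableD.
Qed.

Lemma leb_event_cunion (E : nat -> K -> Prop) : (forall n, leb_event (E n)) ->
  leb_event (fun w => exists n, E n w).
Proof.
move=> mE; rewrite /leb_event.
have -> : (fun w => exists n, E n w) `&` I = \bigcup_n (E n `&` I).
  by apply/seteqP; split => w; [move=> [[n En] Iw]; exists n|move=> [n _ [En Iw]]; split => //; exists n].
exact: bigcupT_measurable.
Qed.

Lemma leb_prob_full : leb_prob (fun=> True) = 1.
Proof.
by rewrite /leb_prob setTI lebesgue_measure_itv /= lte_fin ltr01 -EFinB subr0.
Qed.

Lemma leb_prob_compl E : leb_event E -> leb_prob E + leb_prob (fun w => ~ E w) = 1.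
Proof.
move=> mE; rewrite -leb_prob_full; apply: EFin_inj; rewrite EFinD.
have mnE := leb_event_compl mE.
rewrite -(leb_probE mE) -(leb_probE mnE) -(leb_probE leb_event_full).
rewrite -measureU //; last first.
  by apply/seteqP; split => // w [[Ew _] [nEw _]]; apply: nEw.
congr (leb _); apply/seteqP; split => w; first by case=> -[].
by move=> [_ Iw]; have [Ew|nEw] := pselect (E w); [left|right].
Qed.

Lemma leb_eventU E F : leb_event E -> leb_event F -> leb_event (fun w => E w \/ F w).
Proof. by move=> mE mF; rewrite /leb_event -[X in X `&` I]/(E `|` F) setIUl; apply: measurableU. Qed.

Lemma leb_probU E F : leb_event E -> leb_event F ->
  leb_prob (fun w => E w \/ F w) <= leb_prob E + leb_prob F.
Proof.
move=> mE mF; rewrite -lee_fin EFinD -!leb_probE //; last exact: leb_eventU.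
rewrite -[X in (leb (X `&` I) <= _)%E]/(E `|` F) setIUl; exact: measureU2.
Qed.

Lemma leb_event0 : leb_event (fun=> False).
Proof. by rewrite /leb_event -[X in X `&` I]/(@set0 K) set0I. Qed.

Lemma leb_prob0 : leb_prob (fun=> False) = 0.
Proof. by rewrite /leb_prob -[X in X `&` I]/(@set0 K) set0I measure0. Qed.

Section Locate.
Variables (A : finType) (p : seq A -> K) (a0 : A).
Hypothesis p_ge0 : forall s, 0 <= p s.
Hypothesis p_nil : p [::] = 1.
Hypothesis p_rcons : forall s, p s = \sum_a p (rcons s a).

Let cell s (w : K) : Prop := locate p a0 w (size s) = s.

Let cell_event s : leb_event (cell s).
Proof. by rewrite /leb_event (locate_event a0 p_ge0 p_nil p_rcons); apply: measurable_itv. Qed.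

Let cell_prob s : leb_prob (cell s) = p s.
Proof.
rewrite /leb_prob (locate_event a0 p_ge0 p_nil p_rcons) lebesgue_measure_itv /= lte_fin ltrDl.
by have := p_ge0 s; rewrite le_eqVlt => /predU1P[<-|->]; rewrite ?ltxx //= addrAC subrr add0r.
Qed.

Let cells N (r : seq (N.-tuple A)) : leb_event (fun w => exists2 t, t \in r & locate p a0 w N = t)
  /\ leb_prob (fun w => exists2 t, t \in r & locate p a0 w N = t) <= \sum_(t <- r) p t.
Proof.
elim: r => [|t r [IHe IHp]].
  have -> : (fun w => exists2 t : N.-tuple A, t \in [::] & locate p a0 w N = t) = (fun=> False).
    by apply/funext => w; apply/propext; split => // -[].
  by split; [exact: leb_event0|rewrite leb_prob0 big_nil].
have -> : (fun w => exists2 t' : N.-tuple A, t' \in t :: r & locate p a0 w N = t') =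
    (fun w => cell t w \/ exists2 t' : N.-tuple A, t' \in r & locate p a0 w N = t').
  apply/funext => w; apply/propext; rewrite /cell size_tuple; split.
    move=> [t']; rewrite inE => /predU1P[->|t'r] E; first by left.
    by right; exists t'.
  case=> [E|[t' t'r E]]; first by exists t => //; rewrite mem_head.
  by exists t' => //; rewrite inE t'r orbT.
split; first exact: leb_eventU.
by apply: le_trans (leb_probU (cell_event _) IHe) _; rewrite big_cons cell_prob lerD2l.
Qed.

Let eventE N (D : pred (seq A)) : (fun w => D (locate p a0 w N)) =
  (fun w => exists2 t : N.-tuple A, t \in seq.filter (fun t : N.-tuple A => D t) (enum {: N.-tuple A}) & locate p a0 w N = t)
  :> (K -> Prop).
Proof.
apply/funext => w; apply/propext; split.
  move=> Dw; have sz : size (locate p a0 w N) == N by rewrite size_locate.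
  by exists (Tuple sz) => //; rewrite mem_filter Dw mem_enum.
by move=> [t]; rewrite mem_filter => /andP[Dt _] ->.
Qed.

Lemma locate_event_pred N (D : pred (seq A)) : leb_event (fun w => D (locate p a0 w N)).
Proof. by rewrite eventE; apply: (cells _).1. Qed.

(** Subadditivity over finitely many cylinders. An upper bound is enough, since exact laws will come
    from bounding both an event and its complement. *)
Lemma locate_prob_le N (D : pred (seq A)) :
  leb_prob (fun w => D (locate p a0 w N)) <= \sum_(t : N.-tuple A | D t) p t.
Proof.
rewrite eventE; apply: le_trans (cells _).2 _.
by rewrite big_filter big_enum_cond /=.
Qed.

End Locate.

Lemma leb_prob_sigma (E : nat -> K -> Prop) : (forall n, leb_event (E n)) ->
  (forall n m w, n <> m -> E n w -> E m w -> False) ->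
  forall eps, 0 < eps -> exists M, forall n, (M <= n)%N ->
    `|leb_prob (fun w => exists n, E n w) - \sum_(0 <= i < n) leb_prob (E i)| < eps.
Proof.
move=> mE dE.
have E_ : (fun w => exists n, E n w) `&` I = \bigcup_n (E n `&` I).
  by apply/seteqP; split => w; [move=> [[n En] Iw]; exists n|move=> [n _ [En Iw]]; split => //; exists n].
have tE : trivIset setT (fun n => E n `&` I).
  apply/trivIsetP => i j _ _ ij; rewrite -subset0 => w [[Ei _] [Ej _]].
  by apply: (dE i j w) => //; apply/eqP.
have mU := leb_event_cunion mE.
have EU : leb (\bigcup_n (E n `&` I)) = (leb_prob (fun w => exists n, E n w))%:E.
  by rewrite -(leb_probE mU) E_.
rewrite /leb_event E_ in mU.
have cvE : (fun n => (\sum_(0 <= i < n) leb_prob (E i))%:E) @ \oo -->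
    (leb_prob (fun w => exists n, E n w))%:E.
  rewrite -EU.
  have -> : (fun n => (\sum_(0 <= i < n) leb_prob (E i))%:E) =
      (fun n => \sum_(0 <= i < n) leb (E i `&` I))%E.
    by apply/funext => n; rewrite -sumEFin; apply: eq_bigr => i _; apply/esym/leb_probE.
  exact: (@measure_semi_sigma_additive _ _ _ leb (fun n => E n `&` I) mE tE mU).
have cv : (fun n => \sum_(0 <= i < n) leb_prob (E i)) @ \oo -->
    leb_prob (fun w => exists n, E n w) by apply: fine_cvg cvE.
move=> eps eps0.
have [M _ HM] := (cvgrPdist_lt _ _).1 cv _ eps0.
by exists M.
Qed.

End LebesgueSpace.

Definition leb_space : prob_space.
Proof.
refine (@Build_prob_space R (@leb_event R) (@leb_prob R) (@leb_event_full R)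
  (@leb_event_compl R) (@leb_event_cunion R) (leb_prob_full R) _ _).
  by move=> E _; apply/RleP; apply: fine_ge0.
move=> E mE dE eps /RltP eps0; have [M HM] := leb_prob_sigma mE dE eps0.
(* The sum [sum_f_R0] up to [n] has [n + 1] terms. *)
exists M => n /ssrnat.leP nM; rewrite RdistE distrC sum_f_R0E; apply/RltP.
by apply: HM; lia.
Defined.

Lemma cvg_finsum (K : realType) (U : set_system nat) (I : Type) (r : seq I) (P : pred I)
    (f : I -> nat -> K) (l : I -> K) : Filter U ->
  (forall i, f i @ U --> l i) ->
  (fun k => \sum_(i <- r | P i) f i k) @ U --> \sum_(i <- r | P i) l i.
Proof.
move=> FU fl; elim: r => [|i r IH].
  by rewrite big_nil; under eq_fun do rewrite big_nil; apply: cvg_cst.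
rewrite big_cons; under eq_fun do rewrite big_cons.
by case: (P i) => //; apply: cvgD => //; apply: fl.
Qed.

(** * Limits of consistent weights along an ultrafilter *)

Section UltraLimit.
Variables (K : realType) (A : finType) (W : nat -> seq A -> K).
Hypothesis W_ge0 : forall k s, 0 <= W k s.
Hypothesis W_nil : forall k, W k [::] = 1.
Hypothesis W_rcons : forall k s, W k s = \sum_a W k (rcons s a).

Let W_le1 k s : W k s <= 1.
Proof.
elim/last_ind: s => [|s a IH]; first by rewrite W_nil.
apply: le_trans IH; rewrite (W_rcons k s) (bigD1 a) //= lerDl.
by apply: sumr_ge0 => b _.
Qed.

(** Weights lie in the compact [[0, 1]], so they converge along an ultrafilter finer than [\oo].
    Relations between finite sums survive, and an ordinary limit of [u] is also its limit along the
    ultrafilter. *)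
Lemma ultralimit_weights : exists p : seq A -> K,
  [/\ forall s, 0 <= p s, p [::] = 1, forall s, p s = \sum_a p (rcons s a) &
   forall N (D : pred (seq A)) (u : nat -> K) r,
     (\forall k \near \oo, \sum_(t : N.-tuple A | D t) W k t <= u k) ->
     u @ \oo --> r -> \sum_(t : N.-tuple A | D t) p t <= r].
Proof.
have [U [UU subU]] := ultraFilterLemma (_ : ProperFilter (\oo : set_system nat)).
have limW s : exists l : K, (W ^~ s) @ U --> l.
  have UI : (W ^~ s @ U) (`[0, 1] : set K).
    apply: (@filterE _ U) => k; rewrite /= in_itv /=.
    by apply/andP; split; [exact: W_ge0|exact: W_le1].
  have [l [_ cl]] := @segment_compact K 0 1 (W ^~ s @ U) _ UI.
  (* A cluster point of an ultrafilter is a limit: otherwise the complement of the neighbourhood [V]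
     would belong to it and yet meet [V]. *)
  exists l => V Vl; have [//|UV] := in_ultra_setVsetC (W ^~ s @^-1` V) UU.
  by have [x [nVx Vx]] := cl (~` V) V UV Vl.
have [p Wp] := choice limW.
have uniq (f : nat -> K) (l l' : K) : f @ U --> l -> f @ U --> l' -> l = l'.
  by move=> fl fl'; apply: (cvg_unique (@norm_hausdorff _ K) fl fl').
exists p; split.
- by move=> s; apply: cvgr_to_ge (Wp s) _; apply: filterE => k.
- apply: (uniq (W ^~ [::])) => //; under eq_fun do rewrite W_nil; apply: cvg_cst.
- move=> s; apply: (uniq (W ^~ s)) => //; under eq_fun do rewrite W_rcons.
  by apply: (@cvg_finsum K U A _ _ (fun a k => W k (rcons s a)) (fun a => p (rcons s a))) => a; apply: Wp.
move=> N D u r Wu ur.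
have cW : (fun k => \sum_(t : N.-tuple A | D t) W k t) @ U --> \sum_(t : N.-tuple A | D t) p t.
  by apply: (@cvg_finsum K U _ _ _ (fun (t : N.-tuple A) k => W k t) (fun t : N.-tuple A => p t)).
have cu : u @ U --> r by apply: cvg_trans ur; apply: cvg_app.
by apply: (ler_cvg_to cW cu); apply: subU.
Qed.

End UltraLimit.

(** Only upper bounds pass to the limit; the clause on the complement turns two upper bounds with
    sum one into equalities. *)
Lemma limit_process (A : finType) (a0 : A) (W : nat -> seq A -> R) :
  (forall k s, 0 <= W k s) -> (forall k, W k [::] = 1) ->
  (forall k s, W k s = \sum_a W k (rcons s a)) ->
  exists Z : nat -> Omega leb_space -> A,
    forall N (D : pred (seq A)),
      [/\ measurable leb_space (fun w => D (mkseq (Z^~ w) N)),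
        Q leb_space (fun w => D (mkseq (Z^~ w) N)) +
          Q leb_space (fun w => ~ D (mkseq (Z^~ w) N)) = 1 &
        forall (u : nat -> R) (r : R),
          (\forall k \near \oo, \sum_(t : N.-tuple A | D t) W k t <= u k) ->
          u @ \oo --> r -> Q leb_space (fun w => D (mkseq (Z^~ w) N)) <= r].
Proof.
move=> W0 W1 WS; have [p [p0 p1 pS plim]] := ultralimit_weights W0 W1 WS.
exists (coordinate p a0) => N D.
have -> : (fun w => D (mkseq ((coordinate p a0)^~ w) N)) = (fun w => D (locate p a0 w N)) :> (R -> Prop).
  by apply/funext => w; rewrite locateE.
have -> : (fun w => ~ D (mkseq ((coordinate p a0)^~ w) N)) = (fun w => ~ D (locate p a0 w N)) :> (R -> Prop).
  by apply/funext => w; rewrite locateE.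
have mD := locate_event_pred a0 p0 p1 pS N D.
split => //; first exact: leb_prob_compl.
by move=> u r Wu ur; apply: le_trans (locate_prob_le a0 p0 p1 pS N D) _; apply: plim Wu ur.
Qed.

(** * Exponential functionals of a Markov chain *)

Section ExpBounds.
Variable K : realType.

(** The only analytic input is [1 + x <= expR x]. At [x = (u ^+ 2 - u) / 2], where the square of
    [expR x] is the inverse of the left side, it leaves a polynomial inequality. *)
Lemma expR_sub_sqr_le (u : K) : `|u| <= 1 / 5 -> expR (u - u ^+ 2) <= 1 + u.
Proof.
rewrite ler_norml => /andP[u1 u2].
have [w0 we] : 0 <= 1 + (u ^+ 2 - u) / 2 /\ 1 + (u ^+ 2 - u) / 2 <= expR ((u ^+ 2 - u) / 2).
  by split; [nra|exact: expR_ge1Dx].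
have E : expR (u - u ^+ 2) * expR ((u ^+ 2 - u) / 2) ^+ 2 = 1.
  by rewrite -expRM_natr -expRD -[RHS]expR0; congr expR; field.
set e := expR (u - u ^+ 2) in E *; have e0 : 0 <= e by apply: expR_ge0.
set v := expR _ in we E.
have v2 : (1 + (u ^+ 2 - u) / 2) ^+ 2 <= v ^+ 2 by rewrite ler_pXn2r // nnegrE (le_trans w0).
have H : 1 <= (1 + u) * (1 + (u ^+ 2 - u) / 2) ^+ 2.
  have -> : (1 + u) * (1 + (u ^+ 2 - u) / 2) ^+ 2 =
    1 + u ^+ 2 * (1 / 4 + 3 / 4 * u - u ^+ 2 / 4 + u ^+ 3 / 4) by field.
  by rewrite lerDl mulr_ge0 ?sqr_ge0 //; nra.
have u0 : 0 <= 1 + u by lra.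
have H2 : 1 <= (1 + u) * v ^+ 2 by apply: le_trans H _; apply: ler_wpM2l.
by rewrite -[leLHS]mulr1; apply: le_trans (ler_wpM2l e0 H2) _; rewrite mulrCA E mulr1.
Qed.

Lemma inv_le_expR (v : K) : `|v| <= 1 / 5 -> (1 - v)^-1 <= expR (v + v ^+ 2).
Proof.
move=> v5; have := @expR_sub_sqr_le (- v); rewrite normrN sqrrN => /(_ v5) H.
have p1 := expR_gt0 (- v - v ^+ 2).
have -> : v + v ^+ 2 = - (- v - v ^+ 2) by ring.
by rewrite [leRHS]expRN lef_pV2 // posrE (lt_le_trans p1).
Qed.

(** The same device, with the exponential of [- (u / 2)]. *)
Lemma expR_le_quadratic (u : K) : `|u| <= 1 / 4 -> expR u <= 1 + u + u ^+ 2.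
Proof.
rewrite ler_norml => /andP[u1 u2].
have we : 1 - u / 2 <= expR (- (u / 2)) by apply: expR_ge1Dx.
have w0 : 0 <= 1 - u / 2 by lra.
have E : expR u * expR (- (u / 2)) ^+ 2 = 1.
  by rewrite -expRM_natr -expRD -[RHS]expR0; congr expR; field.
have e0 : 0 <= expR u by apply: expR_ge0.
have q0 : 0 <= 1 + u + u ^+ 2 by nra.
have v2 : (1 - u / 2) ^+ 2 <= expR (- (u / 2)) ^+ 2 by rewrite ler_pXn2r // nnegrE (le_trans w0).
have H : 1 <= (1 + u + u ^+ 2) * (1 - u / 2) ^+ 2.
  have -> : (1 + u + u ^+ 2) * (1 - u / 2) ^+ 2 = 1 + u ^+ 2 * (1 / 4 - 3 / 4 * u + u ^+ 2 / 4) by field.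
  by rewrite lerDl mulr_ge0 ?sqr_ge0 //; nra.
have H2 : 1 <= (1 + u + u ^+ 2) * expR (- (u / 2)) ^+ 2 by apply: le_trans H _; apply: ler_wpM2l.
by rewrite -[leLHS]mulr1; apply: le_trans (ler_wpM2l e0 H2) _; rewrite mulrCA E mulr1.
Qed.

(** Tangent line of the exponential at [\sum_i a i], the mean of the [n.+1%:R * a i]: the linear
    terms cancel in the sum. *)
Lemma expR_Jensen n (a : 'I_n.+1 -> K) :
  expR (\sum_i a i) <= n.+1%:R^-1 * \sum_i expR (n.+1%:R * a i).
Proof.
set S := \sum_i a i; have n0 : (0 : K) < n.+1%:R by rewrite ltr0n.
rewrite mulrC ler_pdivlMr //.
apply: (@le_trans _ _ (\sum_i (expR S * (1 + (n.+1%:R * a i - S))))); last first.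
  apply: ler_sum => i _; rewrite -[in leRHS](subrK S (n.+1%:R * a i)) [in leRHS]addrC expRD.
  by apply: ler_wpM2l; [exact: expR_ge0|exact: expR_ge1Dx].
rewrite -mulr_sumr big_split sumrB -mulr_sumr -/S !sumr_const card_ord /=.
by rewrite -[S *+ _]mulr_natl subrr addr0.
Qed.

End ExpBounds.

(** * Exponential functionals by residue classes of time *)

Section MarkovMgf.
Variables (K : realType) (T : finType) (P : T -> T -> K).
Hypothesis P_ge0 : forall x y, 0 <= P x y.
Hypothesis P_row : forall x, \sum_y P x y = 1.

(** The functional sees [m] states from [x] on, without the endpoint, because a holding time depends
    on the state before the jump. *)
Fixpoint Epath m (x : T) (F : seq T -> K) : K :=
  if m is m'.+1 then \sum_y P x y * Epath m' y (fun s => F (x :: s)) else F [::].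

Lemma Epath_le m x F G : (forall s, size s = m -> F s <= G s) -> Epath m x F <= Epath m x G.
Proof.
elim: m x F G => [|m IH] x F G FG /=; first exact: FG.
apply: ler_sum => y _; apply: ler_wpM2l => //; apply: IH => s sm.
by apply: FG; rewrite /= sm.
Qed.

Lemma eq_Epath m x F G : (forall s, F s = G s) -> Epath m x F = Epath m x G.
Proof. by move=> FG; apply/eqP; rewrite eq_le !Epath_le // => s _; rewrite FG. Qed.

Lemma Epath_ge0 m x F : (forall s, 0 <= F s) -> 0 <= Epath m x F.
Proof.
elim: m x F => [|m IH] x F F0 //=.
by apply: sumr_ge0 => y _; apply: mulr_ge0 => //; apply: IH.
Qed.

Lemma Epath_scale m x a F : Epath m x (fun s => a * F s) = a * Epath m x F.
Proof.
elim: m x F => [|m IH] x F //=.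
by rewrite mulr_sumr; apply: eq_bigr => y _; rewrite IH mulrCA.
Qed.

Lemma Epath_sum m x (I : Type) (r : seq I) (Q : pred I) F :
  Epath m x (fun s => \sum_(i <- r | Q i) F i s) = \sum_(i <- r | Q i) Epath m x (F i).
Proof.
elim: m x F => [|m IH] x F //=.
by rewrite exchange_big; apply: eq_bigr => y _; rewrite IH mulr_sumr.
Qed.

Fixpoint step_pow n (x y : T) : K :=
  if n is n'.+1 then \sum_w P x w * step_pow n' w y else (x == y)%:R.

Lemma step_pow_ge0 n x y : 0 <= step_pow n x y.
Proof.
elim: n x => [|n IH] x /=; first by rewrite ler0n.
by apply: sumr_ge0 => w _; apply: mulr_ge0.
Qed.

Lemma step_pow_row n x : \sum_y step_pow n x y = 1.
Proof.
elim: n x => [|n IH] x /=.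
  by rewrite (bigD1 x) //= eqxx big1 ?addr0 // => y; rewrite eq_sym => /negbTE ->.
by rewrite exchange_big /= -[RHS](P_row x); apply: eq_bigr => w _; rewrite -mulr_sumr IH mulr1.
Qed.

Section Class.
Variables (b' : nat) (g : T -> K).
Let b := b'.+1.

(** [l] counts down to the next selected position and is then reset to [b']; for [l < b] the
    selected positions are those congruent to [l] modulo [b]. *)
Fixpoint class_sum (l : nat) (s : seq T) : K :=
  if s is y :: s' then
    if l is l'.+1 then class_sum l' s' else g y + class_sum b' s'
  else 0.

Lemma sum_class_sum s : \sum_(l < b) class_sum l s = \sum_(y <- s) g y.
Proof.
elim: s => [|y s IH]; first by rewrite big_nil big1.
rewrite big_cons -IH big_ord_recl /= [in RHS]big_ord_recr /= -addrA; congr (_ + _).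
by rewrite addrC.
Qed.

Let G l m x := Epath m x (fun s => expR (b%:R * class_sum l s)).
Let H y := expR (b%:R * g y).
(** Here [x] is the selected state just counted, and [m] positions remain after it. *)
Let G' m x := \sum_y P x y * G b' m y.

Let GS l m x : G l.+1 m.+1 x = \sum_y P x y * G l m y.
Proof. by []. Qed.

Let G0S m x : G 0 m.+1 x = H x * G' m x.
Proof.
rewrite /G /= /G' mulr_sumr; apply: eq_bigr => y _; rewrite mulrCA; congr (_ * _).
by rewrite /G -Epath_scale; apply: eq_Epath => s; rewrite mulrDr expRD.
Qed.

Let G_short l m x : (m <= l)%N -> G l m x = 1.
Proof.
elim: m l x => [|m IH] [|l] x //; rewrite ?ltnS => ml; try by rewrite /G /= mulr0 expR0.
by rewrite GS -[RHS](P_row x); apply: eq_bigr => y _; rewrite IH // mulr1.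
Qed.

Let G_long l m x : G l (l + m).+1 x = \sum_y step_pow l x y * (H y * G' m y).
Proof.
elim: l x => [|l IH] x.
  rewrite add0n G0S (bigD1 x) //= eqxx mul1r big1 ?addr0 // => y.
  by rewrite eq_sym => /negbTE ->; rewrite mul0r.
rewrite addSn GS /=; under eq_bigr do rewrite IH mulr_sumr.
rewrite exchange_big /=; apply: eq_bigr => y _.
by rewrite mulr_suml; apply: eq_bigr => w _; rewrite mulrA.
Qed.

(** Consecutive selected states are [b] steps apart, so the Markov property produces the kernel
    [step_pow b]. *)
Let G'_step m x : G' (b + m) x = \sum_y step_pow b x y * (H y * G' m y).
Proof.
rewrite /G' addSn; under eq_bigr do rewrite G_long mulr_sumr.
rewrite exchange_big /=; apply: eq_bigr => y _.
by rewrite mulr_suml; apply: eq_bigr => w _; rewrite mulrA.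
Qed.

Variables (D M : K).
Hypothesis D_ge1 : 1 <= D.
Hypothesis HD : forall x, \sum_y step_pow b x y * H y <= D.
Hypothesis M_ge1 : 1 <= M.
Hypothesis HM : forall x, H x <= M.

Let H0 y : 0 <= H y. Proof. exact: expR_ge0. Qed.

(** Each complete block costs a factor [D]; a remainder shorter than [b] contains no selected
    position. *)
Let G'_le m x : G' m x <= D ^+ (m %/ b).
Proof.
elim/ltn_ind: m x => m IH x.
have [mb|bm] := ltnP m b.
  rewrite divn_small // expr0 /G' -[leRHS](P_row x); apply: ler_sum => y _.
  by rewrite G_short // mulr1.
have -> : (m %/ b = ((m - b) %/ b).+1)%N by rewrite -{1}(subnKC bm) divnDl // divnn.
rewrite -{1}(subnKC bm) G'_step exprSr.
apply: (@le_trans _ _ (\sum_y step_pow b x y * (H y * D ^+ ((m - b) %/ b)))).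
  apply: ler_sum => y _; apply: ler_wpM2l; first exact: step_pow_ge0.
  by apply: ler_wpM2l => //; apply: IH; rewrite ltn_subrL /= (leq_trans _ bm).
under eq_bigr do rewrite mulrA; rewrite -mulr_suml mulrC.
by apply: ler_wpM2l => //; apply: exprn_ge0; apply: le_trans D_ge1.
Qed.

(** The first selected state may come before the chain has mixed and is bounded by the supremum [M];
    [D] covers the later ones. *)
Lemma Epath_class_le l m x : Epath m x (fun s => expR (b%:R * class_sum l s)) <= M * D ^+ (m %/ b).
Proof.
rewrite -/(G l m x).
have D1 k : 1 <= D ^+ k by apply: exprn_ege1.
have [ml|lm] := leqP m l.
  by rewrite G_short // -[leLHS]mulr1; apply: ler_pM.
have -> : m = (l + (m - l.+1)).+1 by rewrite -addSn subnKC.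
rewrite G_long -[leRHS](mul1r) -(step_pow_row l x) mulr_suml; apply: ler_sum => y _.
apply: ler_wpM2l; first exact: step_pow_ge0.
apply: ler_pM => //.
  apply: sumr_ge0 => w _; apply: mulr_ge0 => //; rewrite /G.
  by apply: Epath_ge0 => s; apply: expR_ge0.
apply: le_trans (G'_le _ _) _; apply: ler_weXn2l => //.
by apply: leq_div2r; rewrite -addSn leq_addl.
Qed.

Lemma Epath_expR_le m x : Epath m x (fun s => expR (\sum_(y <- s) g y)) <= M * D ^+ (m %/ b).
Proof.
apply: (@le_trans _ _ (Epath m x (fun s => b%:R^-1 * \sum_(l < b) expR (b%:R * class_sum l s)))).
  by apply: Epath_le => s _; rewrite -sum_class_sum; apply: expR_Jensen.
rewrite Epath_scale Epath_sum mulrC ler_pdivrMr ?ltr0n //.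
apply: (@le_trans _ _ (\sum_(l < b) M * D ^+ (m %/ b))).
  by apply: ler_sum => l _; apply: Epath_class_le.
by rewrite sumr_const card_ord mulr_natr.
Qed.

End Class.

Variables (pi : T -> K) (z : T) (th eta F V : K) (b' : nat).
Let f x := P x z.
Let p := pi z.
Let b : K := b'.+1%:R.
Hypothesis pi_ge0 : forall x, 0 <= pi x.
Hypothesis pi_sum : \sum_x pi x = 1.
Hypothesis pi_inv : \sum_x pi x * f x = p.
Hypothesis f_le : forall x, f x <= F.
Hypothesis V_def : \sum_x pi x * (f x - p) ^+ 2 = V.
Hypothesis eta01 : 0 <= eta <= 1.
Hypothesis mixing : forall x y, `|step_pow b'.+1 x y - pi y| <= eta * pi y.
Hypothesis th_small : b * `|th| * F <= 1 / 8.

Let p_le : p <= F.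
Proof.
rewrite -pi_inv -[F]mul1r -pi_sum mulr_suml; apply: ler_sum => x _.
by apply: ler_wpM2l.
Qed.

Let p0 : 0 <= p. Proof. exact: pi_ge0. Qed.
Let F0 : 0 <= F. Proof. exact: le_trans p_le. Qed.
Let b1 : 1 <= b. Proof. by rewrite ler1n. Qed.
Let th0 : 0 <= `|th|. Proof. by []. Qed.
Let f0 x : 0 <= f x. Proof. exact: P_ge0. Qed.
Let V0 : 0 <= V.
Proof. by rewrite -V_def; apply: sumr_ge0 => x _; apply: mulr_ge0; rewrite ?sqr_ge0. Qed.

Let th_sqr : th ^+ 2 = `|th| ^+ 2. Proof. by rewrite real_normK ?num_real. Qed.

(** Exponent left by [inv_le_expR] at [v = th * f x] once the mean [th * p] is removed. *)
Let ghat x := th * (f x - p) + th ^+ 2 * f x ^+ 2.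

Let thF : `|th| * F <= 1 / 8.
Proof.
apply: le_trans th_small; rewrite -mulrA -[leLHS]mul1r; apply: ler_wpM2r => //.
exact: mulr_ge0.
Qed.

Let ghat_norm x : `|ghat x| <= 9 / 8 * (`|th| * F).
Proof.
apply: le_trans (ler_normD _ _) _.
have fp : `|f x - p| <= F.
  by rewrite ler_norml; apply/andP; split; have := f0 x; have := f_le x; have := p_le; have := p0; lra.
have -> : `|th ^+ 2 * f x ^+ 2| = `|th| * f x * (`|th| * f x).
  by rewrite -exprMn normrX normrM (ger0_norm (f0 x)) expr2.
have tf : `|th| * f x <= `|th| * F by apply: ler_wpM2l.
have tf0 : 0 <= `|th| * f x by apply: mulr_ge0.
have e1 : `|th * (f x - p)| <= `|th| * F by rewrite normrM; apply: ler_wpM2l.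
have e2 : `|th| * f x * (`|th| * f x) <= `|th| * F * (1 / 8).
  by apply: ler_pM => //; apply: le_trans tf thF.
by apply: le_trans (lerD e1 e2) _; lra.
Qed.

(** The bias due to imperfect mixing, then the squared mean and the variance in the second-order
    terms. *)
Let excess := b * `|th| * eta * p + 3 * b * th ^+ 2 * p ^+ 2 + 7 * b ^+ 2 * th ^+ 2 * V.

Let pi_f2 : \sum_x pi x * f x ^+ 2 = V + p ^+ 2.
Proof.
rewrite -V_def.
have -> : p ^+ 2 = \sum_x (pi x * f x * (2 * p) - pi x * p ^+ 2).
  by rewrite sumrB -!mulr_suml pi_inv pi_sum; ring.
by rewrite -big_split; apply: eq_bigr => x _ /=; ring.
Qed.

Let step_le x (h : T -> K) : (forall y, 0 <= h y) ->
  \sum_y step_pow b'.+1 x y * h y <= 2 * \sum_y pi y * h y.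
Proof.
move=> h0; rewrite mulr_sumr; apply: ler_sum => y _; rewrite mulrA; apply: ler_wpM2r => //.
have := mixing x y; rewrite ler_norml => /andP[_ H].
have : eta * pi y <= 1 * pi y by apply: ler_wpM2r => //; case/andP: eta01.
by move: H; set a := step_pow _ _ _; lra.
Qed.

Let step_mean x : `|\sum_y step_pow b'.+1 x y * (f y - p)| <= eta * p.
Proof.
have -> : \sum_y step_pow b'.+1 x y * (f y - p) = \sum_y (step_pow b'.+1 x y - pi y) * f y.
  under eq_bigr do rewrite mulrBr.
  rewrite sumrB -mulr_suml step_pow_row mul1r -[X in _ - X]pi_inv -sumrB.
  by apply: eq_bigr => y _; rewrite mulrBl.
apply: le_trans (ler_norm_sum _ _ _) _; rewrite -pi_inv mulr_sumr.
by apply: ler_sum => y _; rewrite normrM (ger0_norm (f0 y)) mulrA; apply: ler_wpM2r.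
Qed.

Let excess_ge0 : 0 <= excess.
Proof.
have e0 : 0 <= eta by case/andP: eta01.
have bp : 0 <= b by exact: le_trans b1.
rewrite /excess; move: (th ^+ 2) (sqr_ge0 th) => t t0.
by rewrite !addr_ge0 // !mulr_ge0.
Qed.

Let step_expR x : \sum_y step_pow b'.+1 x y * expR (b * ghat y) <= 1 + excess.
Proof.
have bp : 0 <= b by exact: le_trans b1.
pose h1 y := f y - p; pose h2 y := f y ^+ 2; pose h3 y := (f y - p) ^+ 2.
(* The square in [expR_le_quadratic] is split by [(A + B)^2 <= 2 A^2 + 2 B^2]; the part from
   [th ^+ 2 * f y ^+ 2] only raises the coefficient of [h2] from [1] to [3/2]. With the factor two
   of [step_le], these become the [3] and the [7 = 3 + 4] of [excess]. *)
apply: (@le_trans _ _ (\sum_y step_pow b'.+1 x y *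
   (1 + b * th * h1 y + 3 / 2 * b * th ^+ 2 * h2 y + 2 * b ^+ 2 * th ^+ 2 * h3 y))).
  apply: ler_sum => y _; apply: ler_wpM2l; first exact: step_pow_ge0.
  have bg : `|b * ghat y| <= 1 / 4.
    rewrite normrM (ger0_norm bp); have := ler_wpM2l bp (ghat_norm y).
    have -> : b * (9 / 8 * (`|th| * F)) = 9 / 8 * (b * `|th| * F) by ring.
    by move: th_small; lra.
  apply: le_trans (expR_le_quadratic bg) _.
  have fF := f_le y; have fy0 := f0 y.
  have tf : b * `|th| * f y <= 1 / 8.
    by apply: le_trans th_small; apply: ler_wpM2l => //; apply: mulr_ge0.
  have tf' : `|th| * f y <= 1 / 8 by apply: le_trans thF; apply: ler_wpM2l.
  have E : 2 * (b * th ^+ 2 * f y ^+ 2) ^+ 2 <= 1 / 2 * b * th ^+ 2 * f y ^+ 2.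
    have -> : (b * th ^+ 2 * f y ^+ 2) ^+ 2 = (b * th ^+ 2 * f y ^+ 2) * ((b * `|th| * f y) * (`|th| * f y)).
      by rewrite th_sqr; ring.
    have w0 : 0 <= b * th ^+ 2 * f y ^+ 2 by apply: mulr_ge0; [apply: mulr_ge0|]; rewrite ?sqr_ge0.
    have s1 : (b * `|th| * f y) * (`|th| * f y) <= 1 / 8 * (1 / 8).
      by apply: ler_pM => //; repeat (apply: mulr_ge0 => //).
    by have := ler_wpM2l w0 s1; lra.
  rewrite /ghat -/(h1 y) -/(h2 y).
  have -> : h3 y = h1 y ^+ 2 by [].
  set A := h1 y; rewrite -/(h2 y) in E; set B := h2 y in E *.
  have sq : (b * (th * A + th ^+ 2 * B)) ^+ 2 <= 2 * (b * th * A) ^+ 2 + 2 * (b * th ^+ 2 * B) ^+ 2.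
    by have := sqr_ge0 (b * th * A - b * th ^+ 2 * B); lra.
  by lra.
have h2_ge0 y : 0 <= h2 y by apply: sqr_ge0.
have h3_ge0 y : 0 <= h3 y by apply: sqr_ge0.
have S1 := step_mean x; have S2 := step_le x h2_ge0; have S3 := step_le x h3_ge0.
rewrite /h1 /h2 /h3 in S1 S2 S3 *; rewrite pi_f2 in S2; rewrite V_def in S3.
set m1 := \sum_y _ in S1; set m2 := \sum_y step_pow _ _ _ * _ in S2; set m3 := \sum_y step_pow _ _ _ * _ in S3.
have -> : \sum_y step_pow b'.+1 x y * (1 + b * th * (f y - p) + 3 / 2 * b * th ^+ 2 * (f y) ^+ 2 +
    2 * b ^+ 2 * th ^+ 2 * (f y - p) ^+ 2) =
    1 + b * th * m1 + 3 / 2 * b * th ^+ 2 * m2 + 2 * b ^+ 2 * th ^+ 2 * m3.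
  rewrite -[X in _ = X + _ + _ + _](step_pow_row b'.+1 x) !mulr_sumr -!big_split; apply: eq_bigr => y _ /=; ring.
have B1 : b * th * m1 <= b * `|th| * (eta * p).
  apply: le_trans (ler_norm _) _; rewrite !normrM (ger0_norm bp); apply: ler_wpM2l => //.
  exact: mulr_ge0.
have t20 : 0 <= b * th ^+ 2 by apply: mulr_ge0; rewrite ?sqr_ge0.
have B2 := ler_wpM2l t20 S2.
have b2t : 0 <= b ^+ 2 * th ^+ 2 by apply: mulr_ge0; rewrite ?sqr_ge0.
have B3 := ler_wpM2l b2t S3.
have B4 : b * th ^+ 2 * V <= b ^+ 2 * th ^+ 2 * V.
  by apply: ler_wpM2r => //; apply: ler_wpM2r; rewrite ?sqr_ge0 // expr2 -[leLHS]mul1r; apply: ler_wpM2r.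
rewrite /excess; lra.
Qed.

(** Each holding time contributes [th * p + ghat] to the exponent. The blocks cost [excess / b] per
    step, and the unmixed first sample of a class costs [2 * b * |th| * F]. *)
Lemma mgf_stationary_le (q : option T -> T -> K) m x :
  (forall x y, q (Some x) y = P x y) ->
  mgf q z th m (Some x) <=
  expR (m%:R * (th * p + `|th| * eta * p + 3 * th ^+ 2 * p ^+ 2 + 7 * b * th ^+ 2 * V)
        + 2 * b * `|th| * F).
Proof.
move=> qP.
have bp : 0 < b by exact: lt_le_trans b1.
have mgfE : mgf q z th m (Some x) = Epath m x (fun s => \prod_(y <- s) (1 - th * f y)^-1).
  elim: m x => [|m IH] x /=; first by rewrite big_nil.
  rewrite qP mulr_sumr; apply: eq_bigr => y _; rewrite qP IH mulrCA; congr (_ * _).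
  by rewrite -Epath_scale; apply: eq_Epath => s; rewrite big_cons.
rewrite mgfE.
apply: (@le_trans _ _ (Epath m x (fun s => expR (m%:R * (th * p)) * expR (\sum_(y <- s) ghat y)))).
  apply: Epath_le => s <-; rewrite -expRD.
  have -> : (size s)%:R * (th * p) + \sum_(y <- s) ghat y = \sum_(y <- s) (th * p + ghat y).
    by rewrite [RHS]big_split /= big_const_seq count_predT iter_addr_0 mulr_natl.
  rewrite expR_sum; apply: ler_prod => y _.
  have tf : `|th * f y| <= 1 / 8.
    by rewrite normrM (ger0_norm (f0 y)); apply: le_trans thF; apply: ler_wpM2l.
  apply/andP; split.
    by rewrite invr_ge0; move: tf; rewrite ler_norml => /andP[_ ?]; lra.
  have -> : th * p + ghat y = th * f y + (th * f y) ^+ 2 by rewrite /ghat; ring.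
  by apply: inv_le_expR; apply: le_trans tf _; lra.
rewrite Epath_scale.
set M := expR (2 * b * `|th| * F).
have D1 : 1 <= 1 + excess by rewrite lerDl.
have bF0 : 0 <= b * (`|th| * F) by apply: mulr_ge0; [exact: ltW|exact: mulr_ge0].
have M1 : 1 <= M by rewrite -[leLHS]expR0 ler_expR; have := bF0; lra.
have HM y : expR (b * ghat y) <= M.
  rewrite ler_expR; apply: le_trans (ler_norm _) _; rewrite normrM gtr0_norm //.
  by have := ler_wpM2l (ltW bp) (ghat_norm y); have := bF0; lra.
apply: le_trans (ler_wpM2l (expR_ge0 _) (Epath_expR_le D1 step_expR M1 HM m x)) _.
have E1 : (1 + excess) ^+ (m %/ b'.+1) <= expR (m%:R * (excess / b)).
  apply: (@le_trans _ _ (expR excess ^+ (m %/ b'.+1))).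
    by apply: lerXn2r; rewrite ?nnegrE ?expR_ge0 ?expR_ge1Dx // (le_trans _ D1).
  rewrite -expRM_natl ler_expR; have -> : m%:R * (excess / b) = m%:R / b * excess by ring.
  apply: ler_wpM2r => //.
  rewrite ler_pdivlMr // /b -natrM ler_nat; exact: leq_trunc_div.
apply: (@le_trans _ _ (expR (m%:R * (th * p)) * (M * expR (m%:R * (excess / b))))).
  by do 2 (apply: ler_wpM2l; first exact: expR_ge0).
rewrite /M -!expRD ler_expR le_eqVlt; apply/orP; left; apply/eqP.
by rewrite /excess; field; rewrite gt_eqF.
Qed.

End MarkovMgf.

(** * The coupling *)

Section Tail.
Variables (K : realType) (T : finType) (p : option T -> T -> K).
Hypothesis p_stoch : stochastic p.

(** Since [q / (1 - q) = 1 / (j + 1)], the variable [s] of [Elaw_consumed] is exactly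
    [1 + th / (j + 1)]. *)
Definition accept (j : nat) : K := j.+2%:R^-1.

Lemma accept01 j : 0 < accept j < 1.
Proof. by rewrite /accept invr_gt0 ltr0n /= invf_lt1 ?ltr0n // ltr1n. Qed.

Lemma accept01_le j : 0 <= accept j <= 1.
Proof. by case/andP: (accept01 j) => a b; rewrite !ltW. Qed.

(** Chernoff bound, the sign of [th] selecting the upper or the lower tail. With [u = th / (j + 1)]
    the event is weighed by powers of [expR (u - u ^+ 2)], which is at most [1 + u]; this loss and
    the factors [Num.max 1 s] form the last factor, which tends to one. *)
Lemma Elaw_tail (z : T) (th sg : K) m j n x :
  (forall x, th * p x z < 1) -> `|th| <= j.+1%:R / 5 ->
  Elaw (accept j) p n x (fun ys bs =>
    ((0 <= th * ((consumed z m ys bs)%:R - sg * j.+1%:R)) && (m <= size (mask bs ys))%N)%:R)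
  <= expR (- th * sg) * mgf p z th m x * expR ((th ^+ 2 * sg + `|th| * m%:R) * harmonic j).
Proof.
move=> thp thj; have [q0 q1] := andP (accept01 j).
pose J : K := j.+1%:R; have J0 : 0 < J by rewrite ltr0n.
pose u := th / J; pose s := 1 + u.
have u5 : `|u| <= 1 / 5.
  by rewrite normrM normfV (gtr0_norm J0) ler_pdivrMr //; move: thj; rewrite -/J; lra.
have [ul uu] : - (1 / 5) <= u /\ u <= 1 / 5 by apply/andP; rewrite -ler_norml.
have s0 : 0 <= s by rewrite /s; lra.
have sth : (1 - accept j) * (s - 1) = th * accept j.
  rewrite /s /u /accept /J.
  have : j.+2%:R = j.+1%:R + 1 :> K by rewrite natr1.
  move=> ->; field; apply/andP; split; first by rewrite gt_eqF // -/J; lra.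
  by rewrite gt_eqF.
have := Elaw_consumed (accept01_le j) p_stoch thp n m x q0 q1 s0 sth.
set C := expR (- (u - u ^+ 2) * (sg * J)).
move=> H; apply: (@le_trans _ _ (C * (Num.max 1 s ^+ m * mgf p z th m x))).
  apply: le_trans (ler_wpM2l (expR_ge0 _) H); rewrite -Elaw_scale.
  apply: (Elaw_le (accept01_le j) p_stoch) => ys bs.
  case: (m <= _)%N; last by rewrite andbF !mulr0.
  rewrite andbT mulr1; case: (boolP (0 <= _)) => [ev|_]; last first.
    by apply: mulr_ge0; [exact: expR_ge0|exact: exprn_ge0].
  set c := consumed z m ys bs in ev *.
  have e1 : expR (u - u ^+ 2) ^+ c <= s ^+ c.
    by apply: lerXn2r; rewrite ?nnegrE ?expR_ge0 //; apply: expR_sub_sqr_le.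
  apply: le_trans (ler_wpM2l (expR_ge0 _) e1).
  rewrite /C -expRM_natl -expRD -[leLHS]expR0 ler_expR.
  have -> : - (u - u ^+ 2) * (sg * J) + c%:R * (u - u ^+ 2) =
     (1 - u) / J * (th * (c%:R - sg * J)) by rewrite /u; field; rewrite gt_eqF.
  by apply: mulr_ge0 => //; apply: divr_ge0; [lra|exact: ltW].
have mg0 := mgf_ge0 p_stoch thp m x.
rewrite mulrA [leRHS]mulrAC; apply: ler_wpM2r => //.
have sm : Num.max 1 s ^+ m <= expR (`|u| * m%:R).
  rewrite mulrC expRM_natl; apply: lerXn2r; rewrite ?nnegrE ?expR_ge0 //.
    by rewrite le_max ler01.
  rewrite ge_max -{1}[1]expR0 ler_expR normr_ge0 /=.
  by apply: le_trans (expR_ge1Dx _) _; rewrite ler_expR ler_norm.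
apply: le_trans (ler_wpM2l (expR_ge0 _) sm) _.
rewrite /C -!expRD ler_expR le_eqVlt; apply/orP; left; apply/eqP.
have -> : harmonic j = J^-1 by [].
by rewrite /u normrM normfV (gtr0_norm J0); field; rewrite gt_eqF.
Qed.

(** The mean number of set bits among so many is [j + 2], which tends to infinity. *)
Definition ticks (j : nat) : nat := (j.+2 ^ 2)%N.

Lemma enough_ticks j m : 1 - enough (accept j) (ticks j) m <= 2 ^+ m.+1 * harmonic j.
Proof.
have [q0 q1] := andP (accept01 j).
rewrite lerBlDr -lerBlDl; apply: le_trans (enough_ge (accept01_le j) _ _).
rewrite lerD2l lerN2 exprSr -mulrA; apply: ler_wpM2l; first exact: exprn_ge0.
have q2 : 0 <= accept j / 2 <= 1 by apply/andP; split; lra.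
have := expr_Bernoulli (ticks j) q2; set A := _ ^+ _.
have A0 : 0 <= A by apply: exprn_ge0; lra.
have -> : (ticks j)%:R * (accept j / 2) = j.+2%:R / 2 :> K.
  by rewrite /ticks /accept natrX; field; rewrite -natrD pnatr_eq0.
have -> : harmonic j = j.+1%:R^-1 :> K by [].
rewrite ler_pdivlMr ?ltr0n // => H.
have : A * j.+1%:R <= 2 * (A * (1 + j.+2%:R / 2)).
  rewrite mulrCA; apply: ler_wpM2l => //.
  have -> : j.+2%:R = j.+1%:R + 1 :> K by rewrite natr1.
  have : 0 <= j.+1%:R :> K by apply: ler0n.
  by lra.
by lra.
Qed.

Lemma enough_le1 j n m : enough (accept j) n m <= 1.
Proof.
elim: n m => [|n IH] [|m] //=; rewrite ?ler01 //.
have [q0 q1] := andP (accept01 j); have := IH m; have := IH m.+1.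
by set a := enough _ _ _; set b := enough _ _ m => ??; nra.
Qed.

Lemma cvg_expR_harmonic (r a : K) : (fun j => r * expR (a * harmonic j)) @ \oo --> r.
Proof.
have h0 : (fun j => a * @harmonic K j) @ \oo --> a * 0.
  by apply: cvgM; [exact: cvg_cst|exact: cvg_harmonic].
have h1 : (fun j => r * expR (a * @harmonic K j)) @ \oo --> r * expR (a * 0).
  apply: cvgM; first exact: cvg_cst.
  by apply: (cvg_comp (fun j => a * @harmonic K j) expR h0); exact: continuous_expR.
by rewrite mulr0 expR0 mulr1 in h1.
Qed.

Lemma cvg_add_harmonic (r a : K) : (fun j => r + a * harmonic j) @ \oo --> r.
Proof.
have : (fun j => r + a * @harmonic K j) @ \oo --> r + a * 0.
  apply: cvgD; first exact: cvg_cst.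
  by apply: cvgM; [exact: cvg_cst|exact: cvg_harmonic].
by rewrite mulr0 addr0.
Qed.

Lemma cvg_tails (a : K) (l1 l2 l3 l4 c1 c2 c3 c4 : T -> K) :
  (fun j => a * harmonic j + \sum_z
    (l1 z * expR (c1 z * harmonic j) + l2 z * expR (c2 z * harmonic j) +
     l3 z * expR (c3 z * harmonic j) + l4 z * expR (c4 z * harmonic j))) @ \oo -->
  \sum_z (l1 z + l2 z + l3 z + l4 z).
Proof.
rewrite -[\sum_z _]add0r; apply: cvgD.
  by have := @cvg_add_harmonic 0 a; under eq_fun do rewrite add0r.
apply: cvg_finsum => z.
by apply: cvgD; [apply: cvgD; [apply: cvgD|]|]; apply: cvg_expR_harmonic.
Qed.

End Tail.

(** * Approximate couplings and their limit *)

Section Coupling.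
Variables (T : finType) (z0 : T) (p1 p2 : option T -> T -> R).
Hypotheses (p1_stoch : stochastic p1) (p2_stoch : stochastic p2).

(** The default [z0] appears only when too few proposals are accepted, an event that [short]
    controls. *)
Definition accepted (y : seq T) (b : seq bool) (i : nat) : T := nth z0 (mask b y) i.

Let jnt j := joint (accept R j) p1 p2 (ticks j).

Let pair_at y1 b1 y2 b2 i := (accepted y1 b1 i, accepted y2 b2 i).

Definition prefix_law (j : nat) (s : seq (T * T)) : R :=
  jnt j (fun y1 b1 y2 b2 => (mkseq (pair_at y1 b1 y2 b2) (size s) == s)%:R).

Let jnt_cst j a : jnt j (fun _ _ _ _ => a) = a.
Proof. by rewrite /jnt (joint_fst _ _ p2_stoch _ (fun _ _ => a)) Elaw_cst. Qed.

Let jnt_le j F G : (forall B y1 y2, let b1 := read_bits B (fun=> 0%N) y1 in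
     let b2 := read_bits B (fun=> 0%N) y2 in F y1 b1 y2 b2 <= G y1 b1 y2 b2) ->
  jnt j F <= jnt j G.
Proof. exact: (joint_le (accept01_le _ j) p1_stoch p2_stoch). Qed.

Lemma prefix_law_ge0 j s : 0 <= prefix_law j s.
Proof. by rewrite -[leLHS](jnt_cst j); apply: jnt_le => *; apply: ler0n. Qed.

Lemma prefix_law_nil j : prefix_law j [::] = 1.
Proof. exact: jnt_cst. Qed.

Lemma prefix_law_rcons j s : prefix_law j s = \sum_a prefix_law j (rcons s a).
Proof.
rewrite /prefix_law /jnt -joint_sum; apply: eq_joint => y1 b1 y2 b2.
under eq_bigr do rewrite size_rcons mkseqS eqseq_rcons.
set f := pair_at _ _ _ _; rewrite (bigD1 (f (size s))) //= eqxx andbT big1 ?addr0 // => a.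
by rewrite eq_sym => /negbTE ->; rewrite andbF.
Qed.

Lemma sum_prefix_law j N (D : pred (seq (T * T))) :
  \sum_(t : N.-tuple (T * T) | D t) prefix_law j t =
  jnt j (fun y1 b1 y2 b2 => (D (mkseq (pair_at y1 b1 y2 b2) N))%:R).
Proof.
rewrite /prefix_law /jnt -joint_sum; apply: eq_joint => y1 b1 y2 b2.
set f := pair_at _ _ _ _.
have sz : size (mkseq f N) == N by rewrite size_mkseq.
rewrite big_mkcond (bigD1 (Tuple sz)) //= size_mkseq eqxx big1 ?addr0; first by case: (D _).
move=> t tN; case: (D t) => //; rewrite size_tuple.
by case: eqP => // E; case/eqP: tN; apply: val_inj.
Qed.

Let mkseq_accepted y b m : (m <= size (mask b y))%N -> mkseq (accepted y b) m = take m (mask b y).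
Proof. exact: map_nth_iota0. Qed.

Let short (y : seq T) (b : seq bool) N : R := (~~ (N <= size (mask b y))%N)%:R.

Let Elaw_short p j N : stochastic p ->
  Elaw (accept R j) p (ticks j) None (fun y b => short y b N) <= 2 ^+ N.+1 * harmonic j.
Proof.
move=> ps; apply: le_trans (enough_ticks R j N); rewrite -(Elaw_size _ ps (ticks j) None).
rewrite lerBrDr -Elaw_add -[leRHS](Elaw_cst (accept R j) ps (ticks j) None).
apply: (Elaw_le (accept01_le R j) ps) => y b; rewrite /short.
by case: (N <= _)%N; rewrite ?addr0 ?add0r.
Qed.

Let jnt_shorts j N : jnt j (fun y1 b1 y2 b2 => short y1 b1 N + short y2 b2 N) <=
  2 ^+ N.+2 * harmonic j.
Proof.
rewrite /jnt joint_add (joint_fst _ _ p2_stoch _ (fun y b => short y b N)).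
rewrite (joint_snd _ _ p1_stoch _ (fun y b => short y b N)).
by have := Elaw_short j N p1_stoch; have := Elaw_short j N p2_stoch; rewrite (exprS 2 N.+1); lra.
Qed.

Definition ranges_fail (m1 n m2 : nat) (t : seq (T * T)) : bool :=
  has (fun x => x \notin take n (unzip2 t)) (take m1 (unzip1 t)) ||
  has (fun x => x \notin take m2 (unzip1 t)) (take n (unzip2 t)).

Let tail_event (th sg J : R) (z : T) m y b : R :=
  ((0 <= th * ((consumed z m y b)%:R - sg * J)) && (m <= size (mask b y))%N)%:R.

Let tail_ge0 th sg J z m y b : 0 <= tail_event th sg J z m y b.
Proof. exact: ler0n. Qed.

(* If the range of one chain is not contained in that of the other, at some state it has
   consumed more bits, so one of the two chains is on the wrong side of the threshold. *)
Let not_covered B ya yb ma mb (tha thb sg J : R) x :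
  let ba := read_bits B (fun=> 0%N) ya in let bb := read_bits B (fun=> 0%N) yb in
  x \in take ma (mask ba ya) -> x \notin take mb (mask bb yb) ->
  (ma <= size (mask ba ya))%N -> (mb <= size (mask bb yb))%N -> 0 <= tha -> thb <= 0 ->
  1 <= tail_event tha sg J x ma ya ba + tail_event thb sg J x mb yb bb.
Proof.
move=> ba bb; rewrite !mem_take_mask => /hasP[k]; rewrite mem_iota /= add0n => kc Bk.
move=> /hasPn nB sa sb ta tb.
have cc : (consumed x mb yb bb <= consumed x ma ya ba)%N.
  rewrite leqNgt; apply/negP => lt; have kb : k \in iota 0 (consumed x mb yb bb).
    by rewrite mem_iota /= add0n (ltn_trans kc lt).
  by have := nB k kb; rewrite Bk.
rewrite /tail_event sa sb !andbT.
have [le|lt] := lerP (sg * J) (consumed x ma ya ba)%:R.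
  by rewrite mulr_ge0 ?subr_ge0 // lerDl ler0n.
suff -> : 0 <= thb * ((consumed x mb yb bb)%:R - sg * J) by rewrite lerDr ler0n.
rewrite -(ler_nat R) in cc.
by rewrite -mulrNN mulr_ge0 ?oppr_ge0 // subr_le0 (le_trans cc) // ltW.
Qed.

(** Union bound over the state at which an inclusion fails. The level [sg] separates the counts at
    [m1] and [n], and [sg'] those at [n] and [m2]; the first summand pays for runs with fewer than
    [N] acceptances. *)
Lemma prefix_law_ranges_fail j m1 n m2 N (th1 th2 th3 th4 sg sg' : T -> R) :
  (m1 <= N)%N -> (n <= N)%N -> (m2 <= N)%N ->
  (forall z, 0 <= th1 z) -> (forall z, th2 z <= 0) ->
  (forall z, 0 <= th3 z) -> (forall z, th4 z <= 0) ->
  \sum_(t : N.-tuple (T * T) | ranges_fail m1 n m2 t) prefix_law j t <=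
  2 ^+ N.+2 * harmonic j + \sum_z
   (Elaw (accept R j) p1 (ticks j) None (tail_event (th1 z) (sg z) j.+1%:R z m1) +
    Elaw (accept R j) p2 (ticks j) None (tail_event (th2 z) (sg z) j.+1%:R z n) +
    Elaw (accept R j) p2 (ticks j) None (tail_event (th3 z) (sg' z) j.+1%:R z n) +
    Elaw (accept R j) p1 (ticks j) None (tail_event (th4 z) (sg' z) j.+1%:R z m2)).
Proof.
move=> m1N nN m2N t1 t2 t3 t4; rewrite sum_prefix_law; set J := j.+1%:R.
apply: (@le_trans _ _ (jnt j (fun y1 b1 y2 b2 => (short y1 b1 N + short y2 b2 N) + \sum_z
   (tail_event (th1 z) (sg z) J z m1 y1 b1 + tail_event (th2 z) (sg z) J z n y2 b2 +
    tail_event (th3 z) (sg' z) J z n y2 b2 + tail_event (th4 z) (sg' z) J z m2 y1 b1)))); last first.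
  rewrite /jnt joint_add joint_sum; apply: lerD; first exact: jnt_shorts.
  apply: ler_sum => z _; rewrite !joint_add.
  rewrite !(joint_fst _ _ p2_stoch _ (tail_event _ _ _ _ _)).
  by rewrite !(joint_snd _ _ p1_stoch _ (tail_event _ _ _ _ _)).
apply: jnt_le => B y1 y2 /=.
set b1 := read_bits B _ y1; set b2 := read_bits B _ y2.
have S0 : 0 <= \sum_z (tail_event (th1 z) (sg z) J z m1 y1 b1 + tail_event (th2 z) (sg z) J z n y2 b2 +
    tail_event (th3 z) (sg' z) J z n y2 b2 + tail_event (th4 z) (sg' z) J z m2 y1 b1).
  by apply: sumr_ge0 => z _; rewrite !addr_ge0.
have s10 : 0 <= short y1 b1 N by apply: ler0n.
have s20 : 0 <= short y2 b2 N by apply: ler0n.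
case: (boolP (ranges_fail _ _ _ _)) => [fail|_]; last by rewrite !addr_ge0.
case: (boolP (N <= size (mask b1 y1))%N) => [N1|/negbTE N1]; last first.
  have -> : short y1 b1 N = 1 by rewrite /short N1.
  by rewrite /= -addrA lerDl addr_ge0.
case: (boolP (N <= size (mask b2 y2))%N) => [N2|/negbTE N2]; last first.
  have -> : short y2 b2 N = 1 by rewrite /short N2.
  by rewrite /= addrAC lerDr addr_ge0.
rewrite -[leLHS]add0r; apply: lerD; first by rewrite addr_ge0.
have pre1 m : (m <= N)%N -> take m (unzip1 (mkseq (pair_at y1 b1 y2 b2) N)) = take m (mask b1 y1).
  move=> mN; rewrite /unzip1 /mkseq -map_comp -map_take take_iota (minn_idPl mN).
  by rewrite -mkseq_accepted // (leq_trans mN).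
have pre2 m : (m <= N)%N -> take m (unzip2 (mkseq (pair_at y1 b1 y2 b2) N)) = take m (mask b2 y2).
  move=> mN; rewrite /unzip2 /mkseq -map_comp -map_take take_iota (minn_idPl mN).
  by rewrite -mkseq_accepted // (leq_trans mN).
move: fail; rewrite /ranges_fail !pre1 // !pre2 // => /orP[] /hasP[x xa xb];
  rewrite (bigD1 x) //= -[leLHS]addr0; (apply: lerD; last first;
  [by apply: sumr_ge0 => z _; rewrite !addr_ge0|]).
- have := not_covered (sg x) J xa xb (leq_trans m1N N1) (leq_trans nN N2) (t1 x) (t2 x).
  by move=> H; apply: le_trans H _; rewrite -addrA lerDl addr_ge0.
- have := not_covered (sg' x) J xa xb (leq_trans nN N2) (leq_trans m2N N1) (t3 x) (t4 x).
  by move=> H; apply: le_trans H _; rewrite -addrA lerDr addr_ge0.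
Qed.

Let path_prob01 (p : option T -> T -> R) x s : stochastic p -> 0 <= path_prob p x s <= 1.
Proof.
move=> [q0 q1]; elim: s x => [|a s IH] x /=; first by rewrite ler01 lexx.
have /andP[h0 h1] := IH (Some a); rewrite mulr_ge0 //= -[leRHS]mul1r; apply: ler_pM => //.
by rewrite -(q1 x) (bigD1 a) //= lerDl sumr_ge0.
Qed.

(** Both the event and its complement are bounded from above, as [limit_process] requires. *)
Let Elaw_path p j s : stochastic p ->
  Elaw (accept R j) p (ticks j) None (fun y b => (mkseq (accepted y b) (size s) == s)%:R) <=
    path_prob p None s + 2 ^+ (size s).+1 * harmonic j
  /\ Elaw (accept R j) p (ticks j) None (fun y b => (mkseq (accepted y b) (size s) != s)%:R) <=
    1 - path_prob p None s + 2 ^+ (size s).+1 * harmonic j.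
Proof.
move=> ps; have pre := Elaw_prefix (accept01_le R j) ps (ticks j) None s.
have /andP[pp0 pp1] := path_prob01 None s ps.
have e1 := enough_le1 R j (ticks j) (size s); have e2 := enough_ticks R j (size s).
split.
  apply: (@le_trans _ _ (Elaw (accept R j) p (ticks j) None
      (fun y b => (prefix s (mask b y))%:R + short y b (size s)))).
    apply: (Elaw_le (accept01_le R j) ps) => y b; rewrite /short.
    have [le|_] := leqP (size s) (size (mask b y)); last by rewrite -[leLHS]add0r lerD ?ler0n ?lern1 ?leq_b1.
    by rewrite addr0 mkseq_accepted // prefixE.
  rewrite Elaw_add pre; apply: lerD; last exact: Elaw_short.
  by rewrite -[leRHS]mulr1; apply: ler_wpM2l.
have : Elaw (accept R j) p (ticks j) None (fun y b => (mkseq (accepted y b) (size s) != s)%:R) +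
    path_prob p None s * enough (accept R j) (ticks j) (size s) <= 1.
  rewrite -pre -Elaw_add -[leRHS](Elaw_cst (accept R j) ps (ticks j) None).
  apply: (Elaw_le (accept01_le R j) ps) => y b.
  case: (boolP (prefix s _)) => [pr|_]; last by rewrite addr0 lern1 leq_b1.
  by rewrite mkseq_accepted ?size_prefix // -prefixE pr /= add0r.
set e := enough _ _ _ in e1 e2 *; set X := Elaw _ _ _ _ _; set h := _ * harmonic j in e2 *.
by move=> H; nra.
Qed.

Lemma prefix_law_path1 j s :
  \sum_(t : (size s).-tuple (T * T) | unzip1 t == s) prefix_law j t <=
    path_prob p1 None s + 2 ^+ (size s).+1 * harmonic j
  /\ \sum_(t : (size s).-tuple (T * T) | unzip1 t != s) prefix_law j t <=
    1 - path_prob p1 None s + 2 ^+ (size s).+1 * harmonic j.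
Proof.
rewrite (sum_prefix_law j (size s) (fun t => unzip1 t == s)).
rewrite (sum_prefix_law j (size s) (fun t => unzip1 t != s)).
have [H1 H2] := Elaw_path j s p1_stoch; rewrite -!(joint_fst _ _ p2_stoch) in H1 H2.
by split; [apply: le_trans H1|apply: le_trans H2];
  apply: jnt_le => B y1 y2 /=; rewrite /unzip1 /mkseq -map_comp.
Qed.

Lemma prefix_law_path2 j s :
  \sum_(t : (size s).-tuple (T * T) | unzip2 t == s) prefix_law j t <=
    path_prob p2 None s + 2 ^+ (size s).+1 * harmonic j
  /\ \sum_(t : (size s).-tuple (T * T) | unzip2 t != s) prefix_law j t <=
    1 - path_prob p2 None s + 2 ^+ (size s).+1 * harmonic j.
Proof.
rewrite (sum_prefix_law j (size s) (fun t => unzip2 t == s)).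
rewrite (sum_prefix_law j (size s) (fun t => unzip2 t != s)).
have [H1 H2] := Elaw_path j s p2_stoch; rewrite -!(joint_snd _ _ p1_stoch) in H1 H2.
by split; [apply: le_trans H1|apply: le_trans H2];
  apply: jnt_le => B y1 y2 /=; rewrite /unzip2 /mkseq -map_comp.
Qed.

(** What remains of the bound of [Elaw_tail] as [j] tends to infinity. *)
Definition tail_bound (p : option T -> T -> R) (z : T) th m sg : R := expR (- th * sg) * mgf p z th m None.

Lemma soft_local_time_coupling : exists Z : nat -> Omega leb_space -> T * T,
  [/\ forall n D, measurable leb_space (fun w => D (Z n w) : bool),
    forall N (D : pred (seq (T * T))), Q leb_space (fun w => D (mkseq (Z^~ w) N)) <= 1,
    forall s, Q leb_space (fun w => mkseq (fun i => (Z i w).1) (size s) = s) = path_prob p1 None s,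
    forall s, Q leb_space (fun w => mkseq (fun i => (Z i w).2) (size s) = s) = path_prob p2 None s &
    forall m1 n m2 N (th1 th2 th3 th4 sg sg' : T -> R),
      (m1 <= N)%N -> (n <= N)%N -> (m2 <= N)%N ->
      (forall z, 0 <= th1 z) -> (forall z x, th1 z * p1 x z < 1) ->
      (forall z, th2 z <= 0) ->
      (forall z, 0 <= th3 z) -> (forall z x, th3 z * p2 x z < 1) ->
      (forall z, th4 z <= 0) ->
      Q leb_space (fun w => ranges_fail m1 n m2 (mkseq (Z^~ w) N)) <=
      \sum_z (tail_bound p1 z (th1 z) m1 (sg z) + tail_bound p2 z (th2 z) n (sg z) +
              tail_bound p2 z (th3 z) n (sg' z) + tail_bound p1 z (th4 z) m2 (sg' z))].
Proof.
have [Z HZ] := limit_process (z0, z0) prefix_law_ge0 prefix_law_nil prefix_law_rcons.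
exists Z; split.
- move=> n D; have [mD _ _] := HZ n.+1 (fun t => D (last (z0, z0) t)).
  suff <- : (fun w => D (last (z0, z0) (mkseq (Z^~ w) n.+1)) : Prop) = (fun w => D (Z n w) : Prop) by [].
  by apply/funext => w; rewrite mkseqS last_rcons.
- move=> N D; have [mD Qc _] := HZ N D; rewrite -Qc lerDl.
  by apply/RleP; apply: (Q_nonneg (meas_compl mD)).
- move=> s; have [_ Qc QD] := HZ (size s) (fun t => unzip1 t == s).
  have E w : unzip1 (mkseq (Z^~ w) (size s)) = mkseq (fun i => (Z i w).1) (size s).
    by rewrite /unzip1 /mkseq -map_comp.
  have [_ _ QN] := HZ (size s) (fun t => unzip1 t != s).
  have U1 : Q leb_space (fun w => unzip1 (mkseq (Z^~ w) (size s)) == s) <= path_prob p1 None s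
    := QD _ _ (filterE _ (fun j => (prefix_law_path1 j s).1)) (@cvg_add_harmonic R _ _).
  have U2 : Q leb_space (fun w => unzip1 (mkseq (Z^~ w) (size s)) != s) <= 1 - path_prob p1 None s
    := QN _ _ (filterE _ (fun j => (prefix_law_path1 j s).2)) (@cvg_add_harmonic R _ _).
  have EP : (fun w => mkseq (fun i => (Z i w).1) (size s) = s) =
      (fun w => unzip1 (mkseq (Z^~ w) (size s)) == s : Prop).
    by apply/funext => w; rewrite E; apply/propext; split => /eqP.
  have EN : (fun w => ~ (unzip1 (mkseq (Z^~ w) (size s)) == s)) =
      (fun w => unzip1 (mkseq (Z^~ w) (size s)) != s : Prop).
    by apply/funext => w; apply/propext; split => /negP.
  rewrite EN in Qc; rewrite EP; apply/eqP; rewrite eq_le U1 andTb.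
  rewrite -[leLHS](subKr 1) lerBlDr -[leLHS]Qc lerD2l; exact: U2.
- move=> s; have [_ Qc QD] := HZ (size s) (fun t => unzip2 t == s).
  have E w : unzip2 (mkseq (Z^~ w) (size s)) = mkseq (fun i => (Z i w).2) (size s).
    by rewrite /unzip2 /mkseq -map_comp.
  have [_ _ QN] := HZ (size s) (fun t => unzip2 t != s).
  have U1 : Q leb_space (fun w => unzip2 (mkseq (Z^~ w) (size s)) == s) <= path_prob p2 None s
    := QD _ _ (filterE _ (fun j => (prefix_law_path2 j s).1)) (@cvg_add_harmonic R _ _).
  have U2 : Q leb_space (fun w => unzip2 (mkseq (Z^~ w) (size s)) != s) <= 1 - path_prob p2 None s
    := QN _ _ (filterE _ (fun j => (prefix_law_path2 j s).2)) (@cvg_add_harmonic R _ _).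
  have EP : (fun w => mkseq (fun i => (Z i w).2) (size s) = s) =
      (fun w => unzip2 (mkseq (Z^~ w) (size s)) == s : Prop).
    by apply/funext => w; rewrite E; apply/propext; split => /eqP.
  have EN : (fun w => ~ (unzip2 (mkseq (Z^~ w) (size s)) == s)) =
      (fun w => unzip2 (mkseq (Z^~ w) (size s)) != s : Prop).
    by apply/funext => w; apply/propext; split => /negP.
  rewrite EN in Qc; rewrite EP; apply/eqP; rewrite eq_le U1 andTb.
  rewrite -[leLHS](subKr 1) lerBlDr -[leLHS]Qc lerD2l; exact: U2.
move=> m1 n m2 N th1 th2 th3 th4 sg sg' m1N nN m2N t1 tp1 t2 t3 tp3 t4.
have [_ _ QD] := HZ N (ranges_fail m1 n m2).
have neg (th : T -> R) p (z : T) x : stochastic p -> th z <= 0 -> th z * p x z < 1.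
  move=> ps tz; apply: le_lt_trans ltr01; rewrite -oppr_ge0 -mulNr.
  by apply: mulr_ge0; [rewrite oppr_ge0|apply: ps.1].
pose err th sg m j : R := expR ((th ^+ 2 * sg + `|th| * m%:R) * harmonic j).
pose u j := 2 ^+ N.+2 * harmonic j + \sum_z
  (tail_bound p1 z (th1 z) m1 (sg z) * err (th1 z) (sg z) m1 j +
   tail_bound p2 z (th2 z) n (sg z) * err (th2 z) (sg z) n j +
   tail_bound p2 z (th3 z) n (sg' z) * err (th3 z) (sg' z) n j +
   tail_bound p1 z (th4 z) m2 (sg' z) * err (th4 z) (sg' z) m2 j).
apply: (QD u).
  (* [Elaw_tail] needs [|th| <= (j + 1) / 5]; the sum over all states dominates every parameter, so
     this holds for all large [j] at once. *)
  pose Th := \sum_z (`|th1 z| + `|th2 z| + `|th3 z| + `|th4 z|).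
  have near_j : \forall j \near \oo, Th * 5 <= j%:R by exact: nbhs_infty_ger.
  apply: filterS near_j => j jTh.
  have Thz z : `|th1 z| + `|th2 z| + `|th3 z| + `|th4 z| <= j.+1%:R / 5.
    apply: (@le_trans _ _ Th).
      rewrite /Th (bigD1 z) //= lerDl; apply: sumr_ge0 => y _; by rewrite !addr_ge0.
    rewrite ler_pdivlMr //; apply: le_trans jTh _; by rewrite ler_nat.
  have Th4 z : [/\ `|th1 z| <= j.+1%:R / 5, `|th2 z| <= j.+1%:R / 5,
      `|th3 z| <= j.+1%:R / 5 & `|th4 z| <= j.+1%:R / 5].
    move: (Thz z) (normr_ge0 (th1 z)) (normr_ge0 (th2 z)) (normr_ge0 (th3 z)) (normr_ge0 (th4 z)).
    by move: `|th1 z| `|th2 z| `|th3 z| `|th4 z| => a b c d *; split; lra.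
  apply: le_trans (prefix_law_ranges_fail j sg sg' m1N nN m2N t1 t2 t3 t4) _.
  rewrite /u; apply: lerD => //; apply: ler_sum => z _; have [h1 h2 h3 h4] := Th4 z.
  apply: lerD; [apply: lerD; [apply: lerD|]|].
  - by apply: Elaw_tail => // x; apply: tp1.
  - by apply: Elaw_tail => // x; apply: neg.
  - by apply: Elaw_tail => // x; apply: tp3.
  - by apply: Elaw_tail => // x; apply: neg.
exact: cvg_tails.
Qed.

End Coupling.

(** * Tail estimates *)

Section Mixing.
Variables (K : realType) (T : finType) (P : T -> T -> K) (pi : T -> K).
Hypothesis P_row : forall x, \sum_y P x y = 1.
Hypothesis pi_ge0 : forall x, 0 <= pi x.
Hypothesis pi_sum : \sum_x pi x = 1.
Hypothesis pi_P : forall y, \sum_x pi x * P x y = pi y.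

Lemma step_powD a b x y :
  step_pow P (a + b) x y = \sum_w step_pow P a x w * step_pow P b w y.
Proof.
elim: a x => [|a IH] x /=.
  rewrite (bigD1 x) //= eqxx mul1r big1 ?addr0 // => w.
  by rewrite eq_sym => /negbTE ->; rewrite mul0r.
under eq_bigr do rewrite IH mulr_sumr.
rewrite exchange_big /=; apply: eq_bigr => w _.
by rewrite mulr_suml; apply: eq_bigr => v _; rewrite mulrA.
Qed.

Lemma pi_step_pow n y : \sum_x pi x * step_pow P n x y = pi y.
Proof.
elim: n => [|n IH] /=.
  by rewrite (bigD1 y) //= eqxx mulr1 big1 ?addr0 // => x /negbTE ->; rewrite mulr0.
under eq_bigr do rewrite mulr_sumr; rewrite exchange_big /= -[RHS]IH.
apply: eq_bigr => w _; rewrite -[in RHS]pi_P mulr_suml.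
by apply: eq_bigr => x _; rewrite mulrA.
Qed.

(* The deviation from equilibrium is multiplicative because signed measures of total
   mass zero may be tested against [P^T - pi] instead of [P^T]. *)
Lemma l1_mixing T0 : (forall x, \sum_y `|step_pow P T0 x y - pi y| <= 1 / 2) ->
  forall k x, \sum_y `|step_pow P (k * T0) x y - pi y| <= 2 * (1 / 2) ^+ k.
Proof.
move=> half; elim=> [|k IH] x.
  apply: (@le_trans _ _ (\sum_y (step_pow P 0 x y + pi y))).
    apply: ler_sum => y _; apply: le_trans (ler_normB _ _) _.
    by rewrite !ger0_norm //= ler0n.
  by rewrite big_split (step_pow_row P_row 0 x) pi_sum expr0 mulr1.
have E y : step_pow P (k.+1 * T0) x y - pi y =
    \sum_w (step_pow P (k * T0) x w - pi w) * (step_pow P T0 w y - pi y).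
  rewrite mulSnr step_powD.
  under [RHS]eq_bigr do rewrite mulrBr mulrBl.
  rewrite !sumrB pi_step_pow -mulr_suml sumrB step_pow_row // pi_sum.
  by rewrite subrr mul0r subr0.
apply: (@le_trans _ _ (\sum_y \sum_w `|step_pow P (k * T0) x w - pi w| * `|step_pow P T0 w y - pi y|)).
  by apply: ler_sum => y _; rewrite E; apply: le_trans (ler_norm_sum _ _ _) _;
    apply: ler_sum => w _; rewrite normrM.
rewrite exchange_big /=; under eq_bigr do rewrite -mulr_sumr.
apply: (@le_trans _ _ (\sum_w `|step_pow P (k * T0) x w - pi w| * (1 / 2))).
  by apply: ler_sum => w _; apply: ler_wpM2l.
rewrite -mulr_suml exprSr mulrA; apply: ler_wpM2r; [by lra|exact: IH].
Qed.

(** One coordinate is dominated by the whole sum of [l1_mixing], and the lower bound [ps] turns the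
    absolute error into a relative one. *)
Lemma pointwise_mixing T0 k (ps eta : K) : (forall x, \sum_y `|step_pow P T0 x y - pi y| <= 1 / 2) ->
  (forall y, ps <= pi y) -> 0 <= eta -> 2 * (1 / 2) ^+ k <= eta * ps ->
  forall x y, `|step_pow P (k * T0) x y - pi y| <= eta * pi y.
Proof.
move=> half psmin e0 ek x y; apply: le_trans (_ : _ <= eta * ps) _; last exact: ler_wpM2l.
apply: le_trans ek; apply: le_trans (l1_mixing half k x).
by rewrite (bigD1 y) //= lerDl sumr_ge0.
Qed.

End Mixing.

(** * Chernoff estimates for one chain *)

Section ChainTail.
Variables (K : realType) (T : finType) (P : T -> T -> K) (nu pi : T -> K).
Variables (q : option T -> T -> K) (z : T).
Variables (eta F V n eps : K) (b' : nat).
Let p := pi z.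
Let b : K := b'.+1%:R.
Hypothesis P_ge0 : forall x y, 0 <= P x y.
Hypothesis P_row : forall x, \sum_y P x y = 1.
Hypothesis nu_ge0 : forall x, 0 <= nu x.
Hypothesis nu_sum : \sum_x nu x = 1.
Hypothesis q_None : forall y, q None y = nu y.
Hypothesis q_Some : forall x y, q (Some x) y = P x y.
Hypothesis pi_ge0 : forall x, 0 <= pi x.
Hypothesis pi_sum : \sum_x pi x = 1.
Hypothesis pi_P : forall y, \sum_x pi x * P x y = pi y.
Hypothesis P_le : forall x, P x z <= F.
Hypothesis V_def : \sum_x pi x * (P x z - p) ^+ 2 = V.
Hypothesis p_gt0 : 0 < p.
Hypothesis F_gt0 : 0 < F.
Hypothesis V_gt0 : 0 < V.
Hypothesis eps_gt0 : 0 < eps.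
Hypothesis eps_le : eps <= 1 / 2.
Hypothesis FV : 2 * eps * F * p <= V.
Hypothesis eta01 : 0 <= eta <= eps / 12.
Hypothesis mixing : forall x y, `|step_pow P b'.+1 x y - pi y| <= eta * pi y.
Hypothesis n_large : 48 <= n * eps ^+ 2.
Hypothesis blocks : 24 * b * V <= n * eps ^+ 2 * p ^+ 2.

Let b_ge1 : 1 <= b. Proof. by rewrite ler1n. Qed.

(** [FV] inserted in [blocks], then divided by [eps * p]. *)
Let bF : 48 * b * F <= n * eps * p.
Proof.
have b0 : 0 <= b by exact: le_trans b_ge1.
have H : 24 * b * (2 * eps * F * p) <= n * eps ^+ 2 * p ^+ 2.
  by apply: le_trans blocks; apply: ler_wpM2l => //; apply: mulr_ge0.
have ep : 0 < eps * p by apply: mulr_gt0.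
rewrite -(ler_pM2r ep); apply: le_trans (_ : _ <= n * eps ^+ 2 * p ^+ 2) _.
  by apply: le_trans H; rewrite le_eqVlt; apply/orP; left; apply/eqP; ring.
by rewrite le_eqVlt; apply/orP; left; apply/eqP; ring.
Qed.

Let neps : 48 <= n * eps.
Proof.
have n0 : 0 <= n.
  rewrite -(pmulr_lge0 _ (_ : 0 < eps ^+ 2)); last by rewrite exprn_gt0.
  by apply: le_trans n_large.
apply: le_trans n_large _; rewrite expr2 mulrA -[leRHS]mulr1; apply: ler_wpM2l; last by move: eps_le; lra.
by apply: mulr_ge0 => //; exact: ltW.
Qed.

(** With [X = |th| * n * eps * p], the deviation gains [X/2] and the errors [A1] to [A5] cost [X/6 +
    X/80 + 7X/240 + X/24 + X/24 = 7X/24], which leaves [5X/24]. The factor two bounds the first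
    step, drawn from [nu]. *)
Lemma chain_mgf_tail (th sg : K) m :
  `|th| * p <= eps / 480 -> `|th| * (V * b) <= eps * p / 480 -> th * nu z <= 1 / 2 ->
  m%:R <= 2 * n -> th * (m%:R * p - sg) <= `|th| * (2 * p - n * eps * p / 2) ->
  expR (- th * sg) * mgf q z th m.+1 None <= 2 * expR (- (5 / 24) * `|th| * n * eps * p).
Proof.
move=> th1 th2 thnu mn dev.
have t0 : 0 <= `|th| by [].
have b0 : 0 <= b by exact: le_trans b_ge1.
have th_small : b * `|th| * F <= 1 / 8.
  rewrite -(ler_pM2r V_gt0).
  apply: (@le_trans _ _ (eps * p / 480 * F)).
    rewrite (_ : b * `|th| * F * V = `|th| * (V * b) * F); last by ring.
    by apply: ler_wpM2r => //; exact: ltW.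
  by move: FV V_gt0; rewrite (_ : eps * p / 480 * F = eps * F * p / 480); [lra|field].
have eta01' : 0 <= eta <= 1 by move: eta01 eps_le => /andP[-> ?] ? /=; lra.
have st y := mgf_stationary_le P_ge0 P_row pi_ge0 pi_sum (pi_P z) P_le V_def eta01' mixing th_small m y q_Some.
rewrite /= q_None.
have d1 : 1 / 2 <= 1 - th * nu z by lra.
have inv2 : 0 <= (1 - th * nu z)^-1 <= 2.
  have d0 : 0 < 1 - th * nu z by lra.
  by rewrite invr_ge0 ltW //= -[leRHS]invrK lef_pV2 ?posrE ?invr_gt0 //; lra.
set E := expR (m%:R * _ + _) in st.
have sumle : \sum_y q None y * mgf q z th m (Some y) <= E.
  rewrite -[leRHS]mul1r -nu_sum mulr_suml; apply: ler_sum => y _.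
  by rewrite q_None; apply: ler_wpM2l.
have E0 : 0 <= E by apply: expR_ge0.
apply: (@le_trans _ _ (expR (- th * sg) * (2 * E))).
  apply: ler_wpM2l; first exact: expR_ge0.
  case/andP: inv2 => i0 i2.
  by apply: (@le_trans _ _ ((1 - th * nu z)^-1 * E)); [exact: ler_wpM2l|exact: ler_wpM2r].
rewrite mulrCA; apply: ler_wpM2l => //; rewrite /E -expRD ler_expR.
set t := `|th| in t0 th1 th2 dev th_small *.
have tE : th ^+ 2 = t ^+ 2 by rewrite /t real_normK ?num_real.
rewrite -/p -/b tE.
set X := t * n * eps * p.
have m0 : 0 <= m%:R :> K by apply: ler0n.
have n0 : 0 <= n by lra.
have tp0 : 0 <= t * p by apply: mulr_ge0 => //; exact: ltW.
have A1 : m%:R * (t * eta * p) <= X / 6.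
  have : (m%:R * (t * p)) * eta <= (2 * n * (t * p)) * (eps / 12).
    case/andP: eta01 => e0 e1; apply: ler_pM => //; first exact: mulr_ge0.
    exact: ler_wpM2r.
  by rewrite /X; lra.
have A2 : m%:R * (3 * t ^+ 2 * p ^+ 2) <= X / 80.
  have : (m%:R * (t * p)) * (t * p) <= (2 * n * (t * p)) * (eps / 480).
    by apply: ler_pM => //; [exact: mulr_ge0|exact: ler_wpM2r].
  by rewrite /X; lra.
have A3 : m%:R * (7 * b * t ^+ 2 * V) <= 7 * X / 240.
  have vb0 : 0 <= t * (V * b) by rewrite !mulr_ge0 // ltW.
  have : (m%:R * t) * (t * (V * b)) <= (2 * n * t) * (eps * p / 480).
    by apply: ler_pM => //; [exact: mulr_ge0|exact: ler_wpM2r].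
  by rewrite /X; lra.
have A4 : 2 * b * t * F <= X / 24.
  have := ler_wpM2l t0 bF; rewrite /X; lra.
have A5 : t * (2 * p) <= X / 24.
  have := ler_wpM2l tp0 neps; rewrite /X; lra.
have dev' : th * m%:R * p - th * sg <= t * (2 * p) - X / 2 by move: dev; rewrite /X; lra.
rewrite /X in A1 A2 A3 A4 A5 dev' *; lra.
Qed.

End ChainTail.

Section ChainEstimates.
Variables (K : realType) (T : finType) (P : T -> T -> K) (nu pi : T -> K).
Variables (q : option T -> T -> K) (z : T).
Variables (F V n eps k ps : K) (T0 kk : nat).
Let p := pi z.
Hypothesis P_ge0 : forall x y, 0 <= P x y.
Hypothesis P_row : forall x, \sum_y P x y = 1.
Hypothesis nu_ge0 : forall x, 0 <= nu x.
Hypothesis nu_sum : \sum_x nu x = 1.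
Hypothesis q_None : forall y, q None y = nu y.
Hypothesis q_Some : forall x y, q (Some x) y = P x y.
Hypothesis pi_ge0 : forall x, 0 <= pi x.
Hypothesis pi_sum : \sum_x pi x = 1.
Hypothesis pi_P : forall y, \sum_x pi x * P x y = pi y.
Hypothesis P_le : forall x, P x z <= F.
Hypothesis V_def : \sum_x pi x * (P x z - p) ^+ 2 = V.
Hypothesis p_gt0 : 0 < p.
Hypothesis F_gt0 : 0 < F.
Hypothesis V_gt0 : 0 < V.
Hypothesis eps_gt0 : 0 < eps.
Hypothesis eps_le : eps <= 1 / 2.
Hypothesis FV : 2 * eps * F * p <= V.
Hypothesis half_mixing : forall x, \sum_y `|step_pow P T0 x y - pi y| <= 1 / 2.
Hypothesis ps_min : forall y, ps <= pi y.
Hypothesis k_gt0 : 0 < k.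
Hypothesis kk_ge : (0 < kk)%N.
Hypothesis kk_le : kk%:R <= 2 * k.
Hypothesis kk_mix : 2 * (1 / 2) ^+ kk <= eps / 12 * ps.
Hypothesis n_large : 48 <= n * eps ^+ 2.
Hypothesis blocks_large : 48 <= eps ^+ 2 * p ^+ 2 / V * (n / (k * T0%:R)).

(** The three cases of [error_ge] produce the rates [5/11520], [5/23040] and [5/48]. This value is
    below all of them, and [1 - 48 * decay_rate] still exceeds [1/4], which settles small
    exponents. *)
Definition decay_rate : K := 1 / 10000.

(** When [nu z = 0] the exponent of the middle term is read as minus infinity. *)
Definition chain_error : K :=
  expR (- (decay_rate * n * eps ^+ 2)) +
  (if nu z == 0 then 0 else expR (- (decay_rate * n * eps * p / nu z))) +
  expR (- (decay_rate * eps ^+ 2 * p ^+ 2 / V * (n / (k * T0%:R)))).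

(** The inverse of zero is zero, so [T0 = 0] would turn [blocks_large] into [48 <= 0]. *)
Let T0_gt0 : (0 < T0)%N.
Proof.
rewrite lt0n; apply/eqP => E; move: blocks_large.
by rewrite E mulr0 invr0 !mulr0 leNgt ltr0n.
Qed.

Variable b : K.
Hypothesis b_def : b = (kk * T0)%:R.

Let b_gt0 : 0 < b. Proof. by rewrite b_def ltr0n muln_gt0 kk_ge. Qed.
Let b_ge1 : 1 <= b. Proof. by rewrite b_def ler1n muln_gt0 kk_ge. Qed.

Let kT_gt0 : 0 < k * T0%:R. Proof. by rewrite mulr_gt0 // ltr0n. Qed.

Let b_le : b <= 2 * (k * T0%:R).
Proof. by rewrite b_def natrM mulrA; apply: ler_wpM2r; rewrite ?ler0n. Qed.

Let n_gt0 : 0 < n.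
Proof.
rewrite -(pmulr_lgt0 _ (_ : 0 < eps ^+ 2)); last by rewrite exprn_gt0.
exact: lt_le_trans n_large.
Qed.

Let blocks : 24 * b * V <= n * eps ^+ 2 * p ^+ 2.
Proof.
have H : 48 * (k * T0%:R) * V <= n * eps ^+ 2 * p ^+ 2.
  rewrite -ler_pdivlMr // -ler_pdivlMr //; apply: le_trans blocks_large _.
  by rewrite le_eqVlt; apply/orP; left; apply/eqP; ring.
apply: le_trans H; apply: ler_wpM2r; first exact: ltW.
by move: b_le; lra.
Qed.

Variable e : K.
Hypothesis e_def : e = eps / 480.

Let e_gt0 : 0 < e.
Proof. by rewrite e_def; apply: divr_gt0; [exact: eps_gt0|rewrite ltr0n]. Qed.

(** The largest [|th|] allowed by the first two conditions of [chain_mgf_tail]. *)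
Let phi : K := Num.min (e / p) (e * p / (V * b)).

Let Vb_gt0 : 0 < V * b. Proof. exact: mulr_gt0. Qed.

Let phi_gt0 : 0 < phi.
Proof. by rewrite lt_min !divr_gt0 // mulr_gt0. Qed.

Let phi1 t : t <= phi -> t * p <= e.
Proof. by rewrite le_min => /andP[H _]; rewrite -ler_pdivlMr. Qed.

Let phi2 t : t <= phi -> t * (V * b) <= e * p.
Proof. by rewrite le_min => /andP[_ H]; rewrite -ler_pdivlMr. Qed.

Let phiF t : 0 <= t -> t <= phi -> t * F < 1.
Proof.
move=> t0 /phi2 H.
have h1 : t * V <= e * p.
  by apply: le_trans H; apply: ler_wpM2l => //; rewrite -[leLHS]mulr1; apply: ler_wpM2l => //; exact: ltW.
rewrite e_def in h1; have ep : 0 < eps * p by exact: mulr_gt0.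
have h2 := ler_wpM2l t0 FV.
have : (eps * p) * (t * F) < (eps * p) * 1 by move: h1 h2 ep; lra.
by rewrite ltr_pM2l.
Qed.

(** The parameter saturates one of three constraints, and each of them yields one of the three terms
    of [chain_error]. *)
Let error_ge t : 0 <= t ->
  [\/ t = e / p, t = e * p / (V * b) | nu z != 0 /\ t = 1 / (2 * nu z)] ->
  expR (- (5 / 24) * t * n * eps * p) <= chain_error.
Proof.
move=> t0.
have e0 := expR_ge0; rewrite /chain_error.
set A := expR (- _); set B := if _ then _ else _; set C := expR (- (_ * _)).
have A0 : 0 <= A by exact: e0.
have C0 : 0 <= C by exact: e0.
have B0 : 0 <= B by rewrite /B; case: ifP.
have n0 := ltW n_gt0.
case=> [->|->|[nz ->]].
- suff : expR (- (5 / 24) * (e / p) * n * eps * p) <= A by lra.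
  rewrite ler_expR /decay_rate.
  have -> : - (5 / 24) * (e / p) * n * eps * p = - (5 / 11520) * (n * eps ^+ 2).
    by rewrite e_def; field; rewrite gt_eqF.
  by move: n_large; lra.
- suff : expR (- (5 / 24) * (e * p / (V * b)) * n * eps * p) <= C by lra.
  rewrite ler_expR /decay_rate.
  have -> : - (5 / 24) * (e * p / (V * b)) * n * eps * p =
     - (5 / 11520) * (eps ^+ 2 * p ^+ 2 / V * n * b^-1) by rewrite e_def; field; rewrite !gt_eqF.
  have -> : - (1 / 10000 * eps ^+ 2 * p ^+ 2 / V * (n / (k * T0%:R))) =
     - (1 / 10000) * (eps ^+ 2 * p ^+ 2 / V * n * (k * T0%:R)^-1) by ring.
  set Y := _ / V * n.
  have Y0 : 0 <= Y by rewrite /Y !mulr_ge0 ?invr_ge0 ?sqr_ge0 // ltW.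
  have : Y * ((k * T0%:R)^-1 / 2) <= Y * b^-1.
    apply: ler_wpM2l => //; rewrite -invfM lef_pV2 ?posrE //.
      by rewrite mulrC.
    by apply: mulr_gt0 => //; rewrite ltr0n.
  have : 0 <= Y * (k * T0%:R)^-1 by apply: mulr_ge0 => //; rewrite invr_ge0 ltW.
  lra.
have np : 0 < nu z by rewrite lt_neqAle eq_sym nz /=.
suff : expR (- (5 / 24) * (1 / (2 * nu z)) * n * eps * p) <= B by lra.
rewrite /B (negbTE nz) ler_expR /decay_rate.
have -> : - (5 / 24) * (1 / (2 * nu z)) * n * eps * p = - (5 / 48) * (n * eps * p / nu z).
  by field; rewrite gt_eqF.
have : 0 <= n * eps * p / nu z by rewrite !mulr_ge0 ?invr_ge0 // ltW.
lra.
Qed.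

Let b'S : (kk * T0).-1.+1 = (kk * T0)%N. Proof. by rewrite prednK // muln_gt0 kk_ge. Qed.

Let mixing x y : `|step_pow P (kk * T0).-1.+1 x y - pi y| <= eps / 12 * pi y.
Proof.
rewrite b'S; apply: (pointwise_mixing P_row pi_ge0 pi_sum pi_P half_mixing ps_min) => //.
by apply: divr_ge0; [exact: ltW|exact: ler0n].
Qed.

Let tail (th sg : K) m : `|th| <= phi -> th * nu z <= 1 / 2 ->
  m%:R <= 2 * n -> th * (m%:R * p - sg) <= `|th| * (2 * p - n * eps * p / 2) ->
  expR (- th * sg) * mgf q z th m.+1 None <= 2 * expR (- (5 / 24) * `|th| * n * eps * p).
Proof.
move=> tp tn mn dev.
have eta01 : 0 <= eps / 12 <= eps / 12 by rewrite lexx andbT divr_ge0 // ltW.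
apply: (@chain_mgf_tail _ _ P nu pi q z (eps / 12) F V n eps (kk * T0).-1) => //.
- by rewrite b'S -b_def.
- by rewrite -e_def; apply: phi1.
- by rewrite b'S -b_def mulrAC -e_def; apply: phi2.
Qed.

(** [th] serves the upper tail and is limited by the first step when [nu z] is positive; the lower
    tail takes [- phi], for which the first step is harmless. The index [m.-1] leaves out that step,
    whose law is [nu]. *)
Lemma chain_estimates : exists th thl : K,
  [/\ 0 <= th, forall x, th * q x z < 1, thl <= 0,
    forall m sg, m.-1%:R <= 2 * n -> m.-1%:R * p + n * eps * p / 2 <= sg ->
      expR (- th * sg) * mgf q z th m None <= 2 * chain_error &
    forall m sg, (0 < m)%N -> m.-1%:R <= 2 * n -> sg + n * eps * p / 2 <= m.-1%:R * p + 2 * p ->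
      expR (- thl * sg) * mgf q z thl m None <= 2 * chain_error].
Proof.
pose th := if nu z == 0 then phi else Num.min phi (1 / (2 * nu z)).
have th_le : th <= phi by rewrite /th; case: ifP => // _; rewrite ge_min lexx.
have th_gt0 : 0 < th.
  rewrite /th; case: eqP => [//|/eqP nz]; rewrite lt_min phi_gt0 /=.
  by rewrite divr_gt0 // mulr_gt0 // lt_neqAle eq_sym nz /=.
have thnu : th * nu z <= 1 / 2.
  rewrite /th; case: eqP => [->|/eqP nz]; first by rewrite mulr0; lra.
  have np : 0 < nu z by rewrite lt_neqAle eq_sym nz /=.
  rewrite -ler_pdivlMr //; apply: (@le_trans _ _ (1 / (2 * nu z))); first by rewrite ge_min lexx orbT.
  by rewrite le_eqVlt; apply/orP; left; apply/eqP; field; rewrite gt_eqF.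
have phi_case : phi = e / p \/ phi = e * p / (V * b).
  by rewrite /phi; case: leP => _; [left|right].
have err_th : expR (- (5 / 24) * th * n * eps * p) <= chain_error.
  apply: error_ge; first exact: ltW.
  rewrite /th; case: eqP => [_|/eqP nz]; first by case: phi_case; [constructor 1|constructor 2].
  by case: leP => _; [case: phi_case; [constructor 1|constructor 2]|constructor 3].
have err_phi : expR (- (5 / 24) * phi * n * eps * p) <= chain_error.
  by apply: error_ge; [exact: ltW|case: phi_case; [constructor 1|constructor 2]].
have nep0 : 0 <= n * eps * p by rewrite !mulr_ge0 // ltW.
exists th, (- phi); split; [exact: ltW| |by rewrite oppr_le0 ltW| |].
- case=> [x|]; last by rewrite q_None; apply: le_lt_trans thnu _; lra.
  rewrite q_Some; apply: le_lt_trans (phiF (ltW th_gt0) th_le).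
  by apply: ler_wpM2l; [exact: ltW|exact: P_le].
- move=> m sg mn dev.
  apply: (@le_trans _ _ (2 * expR (- (5 / 24) * th * n * eps * p))); last exact: ler_wpM2l.
  case: m mn dev => [|m] /= mn dev.
    (* For [m = 0] the generating function is one and [sg] alone gives the decay. *)
    have -> : - (5 / 24) * th * n * eps * p = - (5 / 24) * (th * (n * eps * p)) by ring.
    have d1 : th * (n * eps * p / 2) <= th * sg.
      by apply: ler_wpM2l; [exact: ltW|move: dev; rewrite mul0r add0r].
    have X0 : 0 <= th * (n * eps * p) by apply: mulr_ge0 => //; exact: ltW.
    rewrite mulr1; apply: (@le_trans _ _ (expR (- (5 / 24) * (th * (n * eps * p))))).
      by rewrite ler_expR; lra.
    by have := expR_ge0 (- (5 / 24) * (th * (n * eps * p))); lra.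
  have tn : `|th| = th by rewrite gtr0_norm.
  have := @tail th sg m; rewrite tn; apply => //.
  by apply: ler_wpM2l; [exact: ltW|move: dev p_gt0; lra].
- move=> [//|m] sg _ /= mn dev.
  apply: (@le_trans _ _ (2 * expR (- (5 / 24) * phi * n * eps * p))); last exact: ler_wpM2l.
  have tn : `|- phi| = phi by rewrite normrN gtr0_norm.
  have := @tail (- phi) sg m; rewrite tn; apply => //.
    by rewrite mulNr; apply: (@le_trans _ _ 0); [rewrite oppr_le0 mulr_ge0 // ltW|lra].
  rewrite mulNr -mulrN; apply: ler_wpM2l; first exact: ltW.
  by move: dev; lra.
Qed.

End ChainEstimates.

(** * Translation from the definitions of the statement *)

Section StdlibReals.
Local Open Scope R_scope.

Lemma floorN_bounds (x : R) : 0 <= x -> INR (floorN x) <= x < INR (floorN x) + 1.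
Proof.
move=> x0; have [i1 i2] := base_Int_part x.
have z0 : Z.le Z0 (Int_part x).
  have : Z.lt (Zneg xH) (Int_part x) by apply: lt_IZR; Lra.lra.
  exact: Zorder.Zlt_le_succ.
have -> : INR (floorN x) = IZR (Int_part x) by rewrite /floorN INR_IZR_INZ Znat.Z2Nat.id.
by Lra.lra.
Qed.

Lemma pow_half_exp m : (/ 2) ^ m = exp (- (INR m * Rpower.ln 2)).
Proof.
have e2 : Rpower 2 (INR m) = 2 ^ m by apply: Rpower_pow; Lra.lra.
by rewrite exp_Ropp pow_inv -e2.
Qed.

(* [K] is the number of mixing times in a block: the distance to equilibrium is at most
   [2 (1/2)^K] after [K] of them. *)
Lemma log2_block (v k : R) : 0 < v -> v <= / 4 -> - log2 v <= k ->
  exists K : nat, [/\ 0 < k, (0 < K)%N, INR K <= 2 * k & 2 * (/ 2) ^ K <= v].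
Proof.
move=> v0 v4 lk.
have ln2 : 0 < Rpower.ln 2 by have := ln_lt_2; Lra.lra.
have lv : Rpower.ln v <= - 2 * Rpower.ln 2.
  have : Rpower.ln v <= Rpower.ln (/ 4).
    by case: (Rle_lt_or_eq_dec _ _ v4) => [lt|->]; [left; apply: ln_increasing|right].
  rewrite ln_Rinv; last by Lra.lra.
  have -> : 4 = 2 * 2 by Lra.lra.
  by rewrite ln_mult; Lra.lra.
have lkv : - (k * Rpower.ln 2) <= Rpower.ln v.
  have E : Rpower.ln v = (Rpower.ln v / Rpower.ln 2) * Rpower.ln 2 by rewrite /Rdiv Rmult_assoc Rinv_l ?Rmult_1_r //; Lra.lra.
  rewrite E; have := Rmult_le_compat_r (Rpower.ln 2) _ _ (Rlt_le _ _ ln2) lk.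
  by rewrite /log2; Lra.lra.
have k2 : 2 <= k by apply: (Rmult_le_reg_r (Rpower.ln 2)) => //; Lra.lra.
have k0 : 0 <= k by Lra.lra.
have [f1 f2] := floorN_bounds k0.
(* From [k >= 2] this is at most [2 * k]; it exceeds [k + 1], so twice the power of one half is at
   most [2 ^ (- k) <= v]. *)
exists (floorN k).+2; split => //; first by Lra.lra.
  by rewrite !S_INR; Lra.lra.
have -> : 2 * (/ 2) ^ (floorN k).+2 = (/ 2) ^ (floorN k).+1 by rewrite /= -Rmult_assoc Rinv_r ?Rmult_1_l //; Lra.lra.
rewrite pow_half_exp S_INR -[X in _ <= X](exp_ln v) //.
have : - ((INR (floorN k) + 1) * Rpower.ln 2) <= Rpower.ln v.
  have := Rmult_le_compat_r (Rpower.ln 2) k (INR (floorN k) + 1) (Rlt_le _ _ ln2).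
  by Lra.lra.
by case=> [lt|->]; [left; apply: exp_increasing|right].
Qed.

End StdlibReals.

Section Glue.
Variable S : finType.
Implicit Types (P : S -> S -> R) (pi mu nu f : S -> R).

Lemma sumRE f : sumR f = \sum_x f x. Proof. by []. Qed.

Let foldr_min_le a (s : seq S) f y : y \in a :: s -> foldr Rmin (f a) (map f s) <= f y.
Proof.
elim: s y => [|b s IH] y; first by rewrite inE => /eqP ->.
rewrite !inE /= RminE ge_min => /or3P[/eqP ->|/eqP ->|ys].
- by rewrite IH ?mem_head ?orbT.
- by rewrite lexx.
- by rewrite IH ?orbT // inE ys orbT.
Qed.

Let foldr_max_ge a (s : seq S) f y : y \in a :: s -> f y <= foldr Rmax (f a) (map f s).
Proof.
elim: s y => [|b s IH] y; first by rewrite inE => /eqP ->.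
rewrite !inE /= RmaxE le_max => /or3P[/eqP ->|/eqP ->|ys].
- by rewrite IH ?mem_head ?orbT.
- by rewrite lexx.
- by rewrite IH ?orbT // inE ys orbT.
Qed.

Lemma minR_le f x : minR f <= f x.
Proof.
rewrite /minR; have := mem_enum S x; case: (enum S) => [|a s] //= xs.
by apply: foldr_min_le; rewrite xs.
Qed.

Lemma maxR_ge f x : f x <= maxR f.
Proof.
rewrite /maxR; have := mem_enum S x; case: (enum S) => [|a s] //= xs.
by apply: foldr_max_ge; rewrite xs.
Qed.

Lemma minR_gt0 f (x : S) : (forall x, 0 < f x) -> 0 < minR f.
Proof.
move=> f0; rewrite /minR; have := mem_enum S x; case: (enum S) => [|a s] //= _.
by elim: s => [|b s IH] //=; rewrite RminE lt_min f0.
Qed.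

(** [matpow] multiplies on the right, [step_pow] on the left. *)
Lemma matpowE P n x y : matpow P n x y = step_pow P n x y.
Proof.
suff right m u v : step_pow P m.+1 u v = \sum_w step_pow P m u w * P w v.
  elim: n y => [|n IH] y; first by rewrite /=; case: eqP.
  by rewrite right /= sumRE; apply: eq_bigr => w _; rewrite IH.
elim: m u => [|m IH] u.
  rewrite /= (bigD1 v) //= eqxx mulr1 big1 ?addr0 => [|w /negbTE ->]; last by rewrite mulr0.
  by rewrite (bigD1 u) //= eqxx mul1r big1 ?addr0 // => w; rewrite eq_sym => /negbTE ->; rewrite mul0r.
rewrite [LHS]/=; under eq_bigr do rewrite -/(step_pow P m.+1 _ v) IH mulr_sumr.
rewrite exchange_big /=; apply: eq_bigr => w _.
by rewrite mulr_suml; apply: eq_bigr => a _; rewrite mulrA.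
Qed.

Definition start_kernel P nu (x : option S) (y : S) : R := if x is Some x' then P x' y else nu y.

Lemma start_kernel_stochastic P nu : is_transition_matrix P -> is_distribution nu ->
  stochastic (start_kernel P nu).
Proof.
move=> [P0 P1] [nu0 nu1]; split; first by case=> [x|] y; apply/RleP; rewrite /=; [exact: P0|exact: nu0].
by case=> [x|] /=; rewrite -sumRE; [exact: P1|exact: nu1].
Qed.

(** Some state carries mass, irreducibility leads from it to [z], and invariance under the
    corresponding power transports the mass. *)
Lemma invariant_gt0 P pi : is_transition_matrix P -> irreducible P -> is_invariant P pi ->
  forall z, 0 < pi z.
Proof.
move=> [P0 P1] irr [[pi0 pi1] piP] z.
have pi0' x : 0 <= pi x by apply/RleP.
have [x px] : exists x, 0 < pi x.
  apply/not_existsP => no; have : sumR pi = 0.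
    rewrite sumRE big1 // => x _; apply/eqP; rewrite eq_le pi0' andbT leNgt; apply/negP; exact: no.
  by rewrite pi1 => /eqP; rewrite oner_eq0.
have [n /RltP Pn] := irr x z.
have piP' y : \sum_x pi x * P x y = pi y by rewrite -[RHS]piP.
rewrite -(pi_step_pow piP' n z) (bigD1 x) //=; apply: ltr_pwDl.
  by apply: mulr_gt0 => //; rewrite -matpowE.
apply: sumr_ge0 => w _; apply: mulr_ge0 => //.
by apply: step_pow_ge0 => u v; apply/RleP.
Qed.

End Glue.

Lemma IZR2 : IZR 2 = 2%:R. Proof. by rewrite IZRposE INRE. Qed.
Lemma IZR4 : IZR 4 = 4%:R. Proof. by rewrite IZRposE INRE. Qed.
Lemma IZR6 : IZR 6 = 6%:R. Proof. by rewrite IZRposE INRE. Qed.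
Definition stdlib_realE := (IZR2, IZR4, IZR6, RealsE).

Section ChainTerm.
Variable S : finType.

Definition chain_term (c : R) (n : nat) (eps k : R) (P : S -> S -> R) (pi mu nu : S -> R)
    (T0 : nat) (z : S) : R :=
  (Rtrigo_def.exp (- (c * INR n * eps ^ 2)) + init_term c n eps (pi z) (nu z)
    + Rtrigo_def.exp (- (c * eps ^ 2 * gfun pi mu z ^ 2 / variance pi (rho P mu z)
              * (INR n / (k * INR T0)))))%coqR.

Lemma chain_termsE c n eps k P pi mu nu T0 :
  chain_terms c n eps k P pi mu nu T0 = \sum_z chain_term c n eps k P pi mu nu T0 z.
Proof. by []. Qed.

Lemma init_term_ge0 c n eps a b : 0 <= init_term c n eps a b.
Proof. by rewrite /init_term; case: (Req_dec_T b (IZR Z0)) => hb; [exact: lexx|rewrite RexpE; exact: expR_ge0]. Qed.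

Lemma chain_term_ge0 c n eps k P pi mu nu T0 z : 0 <= chain_term c n eps k P pi mu nu T0 z.
Proof. by rewrite /chain_term !RplusE !RexpE !addr_ge0 ?init_term_ge0 ?expR_ge0. Qed.

Lemma chain_tails (P : S -> S -> R) (pi nu mu : S -> R) (T0 : nat) (eps k : R) (n : nat) (z : S) :
  is_transition_matrix P -> irreducible P -> is_invariant P pi -> is_distribution nu ->
  (forall x, 0 < mu x) -> dmix P pi T0 <= 1 / 4 ->
  0 < eps -> eps <= 1 / 2 -> eps <= eps_thr P pi mu -> - klog P pi mu eps <= k ->
  48 <= n%:R * eps ^+ 2 ->
  48 <= eps ^+ 2 * gfun pi mu z ^+ 2 / variance pi (rho P mu z) * (n%:R / (k * T0%:R)) ->
  exists th thl : R, [/\ 0 <= th, forall x, th * start_kernel P nu x z < 1, thl <= 0,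
    forall m (sg : R), (m.-1%:R <= 2 * n%:R :> R) -> m.-1%:R * pi z + n%:R * eps * pi z / 2 <= sg ->
      tail_bound (start_kernel P nu) z th m sg <=
        2 * chain_term (decay_rate R) n eps k P pi mu nu T0 z &
    forall m (sg : R), (0 < m)%N -> (m.-1%:R <= 2 * n%:R :> R) ->
      sg + n%:R * eps * pi z / 2 <= m.-1%:R * pi z + 2 * pi z ->
      tail_bound (start_kernel P nu) z thl m sg <=
        2 * chain_term (decay_rate R) n eps k P pi mu nu T0 z].
Proof.
move=> tP irr iP dnu mu0 mixT eps0 eps1 thr logk nl bl.
have pi_gt0 := invariant_gt0 tP irr iP.
have P0 x y : 0 <= P x y by apply/RleP; apply: tP.1.
have P1 x : \sum_y P x y = 1 by rewrite -sumRE; apply: tP.2.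
have nu0 x : 0 <= nu x by apply/RleP; apply: dnu.1.
have nu1 : \sum_x nu x = 1 by rewrite -sumRE; apply: dnu.2.
have pi1 : \sum_x pi x = 1 by rewrite -sumRE; apply: iP.1.2.
have piP y : \sum_x pi x * P x y = pi y by rewrite -[RHS]iP.2.
set p := pi z; have p0 : 0 < p by exact: pi_gt0.
pose v := variance pi (rho P mu z); pose s := supnorm (rho P mu z).
have muz := mu0 z; have muz0 : mu z != 0 by rewrite gt_eqF.
have gE : gfun pi mu z = p / mu z by rewrite /gfun RdivE.
(* Undoing the normalisation of [rho] by [mu z] scales the norm by [mu z] and the variance by its
   square; the ratio of [gfun ^+ 2] to the variance becomes [p ^+ 2 / V]. *)
pose F := s * mu z; pose V := v * mu z ^+ 2.
have PF x : P x z <= F.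
  rewrite /F -ler_pdivrMr // -RdivE.
  by apply: le_trans (maxR_ge (fun x => Rabs (rho P mu z x)) x); rewrite RabsE /rho ler_norm.
have pF : p <= F.
  rewrite /p -piP -[F]mul1r -pi1 mulr_suml; apply: ler_sum => x _.
  by apply: ler_wpM2l; [exact: ltW|exact: PF].
have F0 : 0 < F by exact: lt_le_trans pF.
have VE : \sum_x pi x * (P x z - p) ^+ 2 = V.
  have eE : expect pi (rho P mu z) = p / mu z.
    rewrite /expect sumRE /p -piP mulr_suml; apply: eq_bigr => x _.
    by rewrite /rho !stdlib_realE mulrA.
  rewrite /V /v /variance eE /expect sumRE mulr_suml; apply: eq_bigr => x _.
  by rewrite /rho !stdlib_realE; field.
have FV : 2 * eps * F * p <= V.
  have s0 : 0 < s by rewrite -(pmulr_lgt0 _ muz) .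
  have := le_trans thr (minR_le _ z); rewrite -/v -/s gE !stdlib_realE.
  rewrite ler_pdivlMr; last by rewrite mulr_gt0 ?divr_gt0 // mulr_gt0 // ltr0n.
  move=> /(ler_wpM2r (ltW (exprn_gt0 2 muz))) H; apply: le_trans H.
  by rewrite le_eqVlt /F; apply/orP; left; apply/eqP; field.
(* The threshold on [eps] excludes a vanishing variance. *)
have V0 : 0 < V.
  have eFp : 0 < eps * F * p by apply: mulr_gt0 => //; apply: mulr_gt0.
  by apply: lt_le_trans FV; move: eFp; lra.
have gV : gfun pi mu z ^+ 2 / v = p ^+ 2 / V.
  have v0 : v != 0 by move: (gt_eqF V0); rewrite /V mulf_eq0 => /negbT; rewrite negb_or => /andP[].
  by rewrite gE /V; field; rewrite muz0 v0.
pose ps := pistar pi; have ps0 : 0 < ps by apply: (minR_gt0 z).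
have ps_min y : ps <= pi y by apply: minR_le.
have ps1 : ps <= 1.
  apply: le_trans (ps_min z) _; rewrite -pi1 (bigD1 z) //= lerDl; apply: sumr_ge0 => y _; exact: ltW.
(* This is the argument of the logarithm in [klog]. By [p <= F] and [FV], [eps * p ^+ 2 / V] is at
   most [1/2], so [w] is below the precision [eps / 12 * ps] asked of a block. *)
pose w := ps * eps ^+ 2 * (p ^+ 2 / V) / 6.
have w0 : 0 < w by rewrite divr_gt0 ?ltr0n // mulr_gt0 ?divr_gt0 ?exprn_gt0 // mulr_gt0 // exprn_gt0.
have w_le : w <= eps / 12 * ps.
  have H : eps * (p ^+ 2 / V) <= 1 / 2.
    rewrite mulrA ler_pdivrMr //; apply: le_trans (_ : _ <= eps * F * p) _; last by move: FV; lra.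
    rewrite expr2 mulrA; apply: ler_wpM2r; first exact: ltW.
    by apply: ler_wpM2l; [exact: ltW|exact: pF].
  have := ler_wpM2l (ltW (mulr_gt0 ps0 eps0)) H; rewrite /w; lra.
have w4 : w <= 1 / 4.
  apply: le_trans w_le _; apply: (@le_trans _ _ (1 / 24 * 1)); last by lra.
  by apply: ler_pM; [apply: divr_ge0; [exact: ltW|exact: ler0n]|exact: ltW|lra|exact: ps1].
have logw : - log2 w <= k.
  apply: le_trans logk; rewrite lerN2; apply: le_trans (minR_le _ z) _.
  rewrite le_eqVlt; apply/orP; left; apply/eqP; congr log2.
  by rewrite !stdlib_realE -/ps -/v /w -gV; field; rewrite -[v]/v; move: (gt_eqF V0); rewrite /V mulf_eq0 => /negbT; rewrite negb_or => /andP[].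
have [kk [/RltP k0 kk0 /RleP kkk /RleP kkw]] : exists K : nat, [/\ (0 < k)%coqR, (0 < K)%N,
    (INR K <= 2 * k)%coqR & (2 * (/ 2) ^ K <= w)%coqR].
  apply: log2_block; [exact/RltP| |exact/RleP].
  by apply/RleP; rewrite !stdlib_realE -div1r.
have half x : \sum_y `|step_pow P T0 x y - pi y| <= 1 / 2.
  have := le_trans (maxR_ge (fun x => tv (matpow P T0 x) pi) x) mixT.
  rewrite /tv sumRE !stdlib_realE => H.
  have -> : \sum_y `|step_pow P T0 x y - pi y| = \sum_y Rabs (Rminus (matpow P T0 x y) (pi y)).
    by apply: eq_bigr => y _; rewrite RabsE matpowE.
  by move: H; set X := \sum_y _; lra.
have kkw' : 2 * (1 / 2) ^+ kk <= eps / 12 * ps.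
  by apply: le_trans w_le; move: kkw; rewrite !stdlib_realE div1r.
have kkk' : kk%:R <= 2 * k by move: kkk; rewrite !stdlib_realE.
have bl' : 48 <= eps ^+ 2 * p ^+ 2 / V * (n%:R / (k * T0%:R)).
  have <- : eps ^+ 2 * gfun pi mu z ^+ 2 / v = eps ^+ 2 * p ^+ 2 / V by rewrite -mulrA gV mulrA.
  exact: bl.
have := @chain_estimates _ _ P nu pi (start_kernel P nu) z F V n%:R eps k ps T0 kk P0 P1 nu0 nu1
  (fun=> erefl) (fun _ _ => erefl) (fun y => ltW (pi_gt0 y)) pi1 piP PF VE p0 F0 V0 eps0 eps1 FV half
  ps_min k0 kk0 kkk' kkw' nl bl' _ erefl _ erefl.
have -> : chain_error nu pi z V n%:R eps k T0 = chain_term (decay_rate R) n eps k P pi mu nu T0 z.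
  rewrite /chain_error /chain_term !RplusE; congr (_ + _ + _).
  - by rewrite RexpE !stdlib_realE.
  - rewrite /init_term; case: (Req_dec_T (nu z) (IZR Z0)) => [n0|/eqP/negbTE n0] /=.
      by rewrite n0 eqxx.
    by rewrite n0 RexpE !stdlib_realE.
  - rewrite RexpE !stdlib_realE -/v; congr (expR (- _)).
    rewrite -[_ * _ / V]mulrA -gV; ring.
by [].
Qed.

End ChainTerm.

(** * Assembly of the four tails *)

Lemma mem_take_unzip1 (T : finType) (Z : nat -> T * T) m N x : (m <= N)%N ->
  reflect (exists i, (i < m)%N /\ (Z i).1 = x) (x \in take m (unzip1 (mkseq Z N))).
Proof.
move=> mN; rewrite /unzip1 /mkseq -map_comp -map_take take_iota (minn_idPl mN).
apply: (iffP mapP) => [[i]|[i [im <-]]].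
  by rewrite mem_iota add0n => im ->; exists i.
by exists i; rewrite ?mem_iota.
Qed.

Lemma mem_take_unzip2 (T : finType) (Z : nat -> T * T) m N x : (m <= N)%N ->
  reflect (exists i, (i < m)%N /\ (Z i).2 = x) (x \in take m (unzip2 (mkseq Z N))).
Proof.
move=> mN; rewrite /unzip2 /mkseq -map_comp -map_take take_iota (minn_idPl mN).
apply: (iffP mapP) => [[i]|[i [im <-]]].
  by rewrite mem_iota add0n => im ->; exists i.
by exists i; rewrite ?mem_iota.
Qed.

Lemma ranges_failP (O : Type) (T : finType) (Z : nat -> O -> T * T) m1 n m2 N w :
  (m1 <= N)%N -> (n <= N)%N -> (m2 <= N)%N ->
  ~ ((forall x, visited (fun n w => (Z n w).1) m1 w x -> visited (fun n w => (Z n w).2) n w x) /\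
     (forall x, visited (fun n w => (Z n w).2) n w x -> visited (fun n w => (Z n w).1) m2 w x)) <->
  ranges_fail m1 n m2 (mkseq (Z^~ w) N).
Proof.
move=> m1N nN m2N; split.
  move=> H; apply/negPn/negP; rewrite negb_or => /andP[/hasPn h1 /hasPn h2]; apply: H; split => x v.
    by have /h1 /negPn /(mem_take_unzip2 _ _ nN) := introT (mem_take_unzip1 _ _ m1N) v.
  by have /h2 /negPn /(mem_take_unzip1 _ _ m2N) := introT (mem_take_unzip2 _ _ nN) v.
case/orP=> /hasP[x xa xb] [h1 h2]; move/negP: xb; apply.
  by apply/mem_take_unzip2 => //; apply: h1; apply/(mem_take_unzip1 _ _ m1N).
by apply/mem_take_unzip1 => //; apply: h2; apply/(mem_take_unzip2 _ _ nN).
Qed.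

Lemma path_prob_mkseq (S : finType) (P : S -> S -> R) (nu : S -> R) (x : nat -> S) m :
  path_prob (start_kernel P nu) None (mkseq x m.+1) =
  nu (x 0%N) * prodR_range m (fun i => P (x i) (x i.+1)).
Proof.
have gen l : path_prob (start_kernel P nu) (Some (x l)) [seq x i | i <- iota l.+1 m] =
    \prod_(l <= i < l + m) P (x i) (x i.+1).
  elim: m l => [|m IH] l; first by rewrite addn0 big_geq.
  by rewrite /= IH [RHS]big_ltn ?addSnnS // -[X in (X < _)%N]addn0 ltn_add2l.
by rewrite /mkseq /= gen add0n.
Qed.

Lemma decay_rate_gt0 (K : realType) : 0 < decay_rate K.
Proof. by rewrite /decay_rate; lra. Qed.

Lemma chain_term_ge (S : finType) (P : S -> S -> R) (pi mu nu : S -> R) (T0 : nat) (eps k : R) n z :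
  expR (- (decay_rate R * (n%:R * eps ^+ 2))) <= chain_term (decay_rate R) n eps k P pi mu nu T0 z /\
  expR (- (decay_rate R * (eps ^+ 2 * gfun pi mu z ^+ 2 / variance pi (rho P mu z) *
     (n%:R / (k * T0%:R))))) <= chain_term (decay_rate R) n eps k P pi mu nu T0 z.
Proof.
rewrite /chain_term !RexpE !stdlib_realE !mulrA.
set a := expR _; set b := init_term _ _ _ _ _; set d := expR _.
have a0 : 0 <= a by apply: expR_ge0.
have b0 : 0 <= b by apply: init_term_ge0.
have d0 : 0 <= d by apply: expR_ge0.
by split; lra.
Qed.

Lemma main_bound (S : finType) (P1 P2 : S -> S -> R) (pi nu1 nu2 mu : S -> R)
    (PS : prob_space) (Z : nat -> Omega PS -> S * S) (z0 : S) :
  is_transition_matrix P1 -> is_transition_matrix P2 ->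
  irreducible P1 -> irreducible P2 -> is_invariant P1 pi -> is_invariant P2 pi ->
  is_distribution nu1 -> is_distribution nu2 -> (forall z, Rlt (IZR Z0) (mu z)) ->
  (forall N (D : pred (seq (S * S))), Q PS (fun w => D (mkseq (Z^~ w) N)) <= 1) ->
  (forall m1 n m2 N (th1 th2 th3 th4 sg sg' : S -> R),
      (m1 <= N)%N -> (n <= N)%N -> (m2 <= N)%N ->
      (forall z, 0 <= th1 z) -> (forall z x, th1 z * start_kernel P1 nu1 x z < 1) ->
      (forall z, th2 z <= 0) ->
      (forall z, 0 <= th3 z) -> (forall z x, th3 z * start_kernel P2 nu2 x z < 1) ->
      (forall z, th4 z <= 0) ->
      Q PS (fun w => ranges_fail m1 n m2 (mkseq (Z^~ w) N)) <=
      \sum_z (tail_bound (start_kernel P1 nu1) z (th1 z) m1 (sg z) +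
              tail_bound (start_kernel P2 nu2) z (th2 z) n (sg z) +
              tail_bound (start_kernel P2 nu2) z (th3 z) n (sg' z) +
              tail_bound (start_kernel P1 nu1) z (th4 z) m2 (sg' z))) ->
  forall (T1 T2 : nat), dmix P1 pi T1 <= 1 / 4 -> dmix P2 pi T2 <= 1 / 4 ->
  forall (eps : R) (n : nat), 0 < eps -> eps <= 1 / 2 ->
    eps <= eps_thr P1 pi mu -> eps <= eps_thr P2 pi mu ->
    Q PS (fun w => ~ Gtilde (fun n w => (Z n w).1) (fun n w => (Z n w).2) n eps w) <=
    4 * \sum_z (chain_term (decay_rate R) n eps (kfun P1 P2 pi mu eps) P1 pi mu nu1 T1 z +
                chain_term (decay_rate R) n eps (kfun P1 P2 pi mu eps) P2 pi mu nu2 T2 z).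
Proof.
move=> tP1 tP2 irr1 irr2 iP1 iP2 dnu1 dnu2 mu0' Q1 tails T1 T2 mix1 mix2 eps n e0 e12 thr1 thr2.
set k := kfun P1 P2 pi mu eps.
have mu0 z : 0 < mu z by apply/RltP; apply: mu0'.
pose A1 z := chain_term (decay_rate R) n eps k P1 pi mu nu1 T1 z.
pose A2 z := chain_term (decay_rate R) n eps k P2 pi mu nu2 T2 z.
have A1_ge0 z : 0 <= A1 z by exact: chain_term_ge0.
have A2_ge0 z : 0 <= A2 z by exact: chain_term_ge0.
set m1 := floorN (INR n * (1 - eps))%coqR; set m2 := floorN (INR n * (1 + eps))%coqR.
pose N := maxn (maxn m1 n) m2.
have [m1N nN m2N] : [/\ (m1 <= N)%N, (n <= N)%N & (m2 <= N)%N].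
  by rewrite /N !leq_max !leqnn !orbT.
have -> : (fun w => ~ Gtilde (fun n w => (Z n w).1) (fun n w => (Z n w).2) n eps w) =
    (fun w => ranges_fail m1 n m2 (mkseq (Z^~ w) N)).
  by apply/funext => w; apply/propext; apply: ranges_failP.
(* A probability is at most one, so with the constant [4] a single term of size [1/4] settles the
   claim. *)
have big1 z : 1 / 4 <= A1 z + A2 z -> Q PS (fun w => ranges_fail m1 n m2 (mkseq (Z^~ w) N)) <=
    4 * \sum_z (A1 z + A2 z).
  move=> H; apply: le_trans (Q1 _ _) _; rewrite (bigD1 z) //=.
  have : 0 <= \sum_(i | i != z) (A1 i + A2 i) by apply: sumr_ge0 => i _; rewrite addr_ge0.
  by move: H; set a := A1 z + A2 z; set b := \sum_(i | _) _; lra.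
have small_exp (a : R) : a < 48 -> 1 / 4 <= expR (- (decay_rate R * a)).
  by move=> a48; apply: le_trans (expR_ge1Dx _); rewrite /decay_rate; lra.
have k1 : - klog P1 pi mu eps <= k by rewrite /k /kfun RoppE RminE lerN2 ge_min lexx.
have k2 : - klog P2 pi mu eps <= k by rewrite /k /kfun RoppE RminE lerN2 ge_min lexx orbT.
have [nl|nl] := ltP (n%:R * eps ^+ 2) 48.
  apply: (big1 z0); apply: le_trans (small_exp _ nl) _; rewrite -[leLHS]addr0.
  by apply: lerD => //; apply: (chain_term_ge P1 pi mu nu1 T1 eps k n z0).1.
pose B1 z := eps ^+ 2 * gfun pi mu z ^+ 2 / variance pi (rho P1 mu z) * (n%:R / (k * T1%:R)).
pose B2 z := eps ^+ 2 * gfun pi mu z ^+ 2 / variance pi (rho P2 mu z) * (n%:R / (k * T2%:R)).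
have [[z [bz|bz]]|large] := pselect (exists z, B1 z < 48 \/ B2 z < 48).
- apply: (big1 z); apply: le_trans (small_exp _ bz) _; rewrite -[leLHS]addr0.
  by apply: lerD => //; apply: (chain_term_ge P1 pi mu nu1 T1 eps k n z).2.
- apply: (big1 z); apply: le_trans (small_exp _ bz) _; rewrite -[leLHS]add0r.
  by apply: lerD => //; apply: (chain_term_ge P2 pi mu nu2 T2 eps k n z).2.
have large1 z : 48 <= B1 z by rewrite leNgt; apply/negP => h; apply: large; exists z; left.
have large2 z : 48 <= B2 z by rewrite leNgt; apply/negP => h; apply: large; exists z; right.
have [c1 c1P] := choice (fun z => chain_tails tP1 irr1 iP1 dnu1 mu0 mix1 e0 e12 thr1 k1 nl (large1 z)).
have [d1 d1P] := choice c1P.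
have [c2 c2P] := choice (fun z => chain_tails tP2 irr2 iP2 dnu2 mu0 mix2 e0 e12 thr2 k2 nl (large2 z)).
have [d2 d2P] := choice c2P.
have n0 : 0 <= n%:R :> R by apply: ler0n.
have neps : 48 <= n%:R * eps.
  apply: le_trans nl _; rewrite expr2 mulrA -[leRHS]mulr1; apply: ler_wpM2l; last by lra.
  by apply: mulr_ge0 => //; exact: ltW.
have pi_gt0 := invariant_gt0 tP1 irr1 iP1.
have [m1le m1gt] : m1%:R <= n%:R * (1 - eps) /\ n%:R * (1 - eps) < m1%:R + 1.
  have h : (0 <= INR n * (1 - eps))%coqR by apply/RleP; rewrite !stdlib_realE mulr_ge0 // subr_ge0; lra.
  by have [/RleP a /RltP b] := floorN_bounds h; rewrite -/m1 !stdlib_realE in a b.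
have [m2le m2gt] : m2%:R <= n%:R * (1 + eps) /\ n%:R * (1 + eps) < m2%:R + 1.
  have h : (0 <= INR n * (1 + eps))%coqR by apply/RleP; rewrite !stdlib_realE mulr_ge0 // addr_ge0 // ltW.
  by have [/RleP a /RltP b] := floorN_bounds h; rewrite -/m2 !stdlib_realE in a b.
have ngt0 : (0 < n)%N by rewrite -(ltr0n R) -(pmulr_lgt0 _ e0); apply: lt_le_trans neps; rewrite ltr0n.
have ne2 : n%:R * eps <= n%:R * (1 / 2) by apply: ler_wpM2l.
have m2gt0 : (0 < m2)%N by rewrite -(ltr0n R); lra.
have predE m : (0 < m)%N -> m.-1%:R = m%:R - 1 :> R by case: m => // m _; rewrite -natr1 addrK.
have pred_le m : m.-1%:R <= m%:R :> R by rewrite ler_nat leq_pred.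
(* The two levels lie halfway between the stationary soft local times after [n (1 - eps)], [n] and
   [n (1 + eps)] steps, so every tail deviates by [n eps pi(z) / 2] up to rounding. *)
apply: le_trans (tails m1 n m2 N c1 d2 c2 d1 (fun z => n%:R * (1 - eps / 2) * pi z)
   (fun z => n%:R * (1 + eps / 2) * pi z) m1N nN m2N _ _ _ _ _ _) _.
- by move=> z; have [] := d1P z.
- by move=> z; have [] := d1P z.
- by move=> z; have [] := d2P z.
- by move=> z; have [] := d2P z.
- by move=> z; have [] := d2P z.
- by move=> z; have [] := d1P z.
rewrite mulr_sumr; apply: ler_sum => z _.
have [_ _ _ up1 low1] := d1P z; have [_ _ _ up2 low2] := d2P z.
have pz := ltW (pi_gt0 z).
have t1 := up1 m1 (n%:R * (1 - eps / 2) * pi z).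
have t2 := low2 n (n%:R * (1 - eps / 2) * pi z) ngt0.
have t3 := up2 n (n%:R * (1 + eps / 2) * pi z).
have t4 := low1 m2 (n%:R * (1 + eps / 2) * pi z) m2gt0.
rewrite -/(A1 z) in t1 t4; rewrite -/(A2 z) in t2 t3.
have pm1 := pred_le m1.
have h1 : m1.-1%:R <= 2 * n%:R :> R by lra.
have h1' : m1.-1%:R * pi z + n%:R * eps * pi z / 2 <= n%:R * (1 - eps / 2) * pi z.
  have := ler_wpM2r pz (le_trans pm1 m1le); lra.
have h2 : n.-1%:R <= 2 * n%:R :> R by have := pred_le n; lra.
have h2' : n%:R * (1 - eps / 2) * pi z + n%:R * eps * pi z / 2 <= n.-1%:R * pi z + 2 * pi z.
  by rewrite predE //; lra.
have h3' : n.-1%:R * pi z + n%:R * eps * pi z / 2 <= n%:R * (1 + eps / 2) * pi z.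
  by rewrite predE //; lra.
have h4 : m2.-1%:R <= 2 * n%:R :> R by have := pred_le m2; lra.
(* Here [m2 - 1 > n (1 + eps) - 2]: the integer part and the omitted first step account for
   [2 * pi z]. *)
have h4' : n%:R * (1 + eps / 2) * pi z + n%:R * eps * pi z / 2 <= m2.-1%:R * pi z + 2 * pi z.
  by rewrite predE //; have := ler_wpM2r pz (ltW m2gt); lra.
have := t1 h1 h1'; have := t2 h2 h2'; have := t3 h2 h3'; have := t4 h4 h4'.
rewrite -/(A1 z) -/(A2 z).
by move: (A1 z) (A2 z) => a1 a2; lra.
Qed.

Local Close Scope classical_set_scope.
Local Close Scope ring_scope.
Local Open Scope R_scope.

Theorem theorem3p2 :
  exists c C : R, 0 < c /\ 0 < C /\
  forall (S : finType) (P1 P2 : S -> S -> R) (pi nu1 nu2 mu : S -> R),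
    is_transition_matrix P1 -> is_transition_matrix P2 ->
    irreducible P1 -> irreducible P2 ->
    is_invariant P1 pi -> is_invariant P2 pi ->
    is_distribution nu1 -> is_distribution nu2 ->
    (forall z, 0 < mu z) ->
    exists (PS : prob_space) (Z1 Z2 : nat -> Omega PS -> S),
      is_markov_chain Z1 P1 nu1 /\ is_markov_chain Z2 P2 nu2 /\
      forall (T1 T2 : nat), is_mixing_time P1 pi T1 -> is_mixing_time P2 pi T2 ->
      forall (eps : R) (n : nat),
        0 < eps ->
        eps <= Rmin (/ 2) (Rmin (eps_thr P1 pi mu) (eps_thr P2 pi mu)) ->
        2 * kfun P1 P2 pi mu eps * INR (Nat.max T1 T2) <= INR n ->
        Q PS (fun w => ~ Gtilde Z1 Z2 n eps w)
        <= C * (chain_terms c n eps (kfun P1 P2 pi mu eps) P1 pi mu nu1 T1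
                + chain_terms c n eps (kfun P1 P2 pi mu eps) P2 pi mu nu2 T2).
Proof.
(* Each chain enters two tails, each at most twice its term, whence the constant [4]. *)
exists (decay_rate R), 4; split; first by apply/RltP; exact: decay_rate_gt0.
split; first by Lra.lra.
move=> S P1 P2 pi nu1 nu2 mu tP1 tP2 irr1 irr2 iP1 iP2 dnu1 dnu2 mu0.
(* Total mass one excludes an empty state space. *)
have [z0 _] : exists z : S, True.
  apply/not_existsP => no; have := dnu1.2; rewrite sumRE big1 => [/eqP|z _]; last by case: (no z).
  by rewrite eq_sym oner_eq0.
have [Z [mZ Q1 law1 law2 tails]] := soft_local_time_coupling z0
  (start_kernel_stochastic tP1 dnu1) (start_kernel_stochastic tP2 dnu2).
exists leb_space, (fun n w => (Z n w).1), (fun n w => (Z n w).2).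
split; [|split].
- split=> [n x|m x].
    have := mZ n (fun a => a.1 == x); congr (measurable leb_space _).
    by apply/funext => w; apply/propext; split => /eqP.
  have := law1 (mkseq x m.+1); rewrite path_prob_mkseq size_mkseq; apply: etrans.
  congr (Q leb_space _); apply/funext => w; apply/propext; split => h.
    by apply/eq_in_map => i; rewrite mem_iota add0n => /andP[_ im]; apply: h.
  move=> i im; have := congr1 (fun s => nth z0 s i) h; by rewrite !nth_mkseq.
- split=> [n x|m x].
    have := mZ n (fun a => a.2 == x); congr (measurable leb_space _).
    by apply/funext => w; apply/propext; split => /eqP.
  have := law2 (mkseq x m.+1); rewrite path_prob_mkseq size_mkseq; apply: etrans.
  congr (Q leb_space _); apply/funext => w; apply/propext; split => h.
    by apply/eq_in_map => i; rewrite mem_iota add0n => /andP[_ im]; apply: h.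
  move=> i im; have := congr1 (fun s => nth z0 s i) h; by rewrite !nth_mkseq.
move=> T1 T2 [/RleP mix1 _] [/RleP mix2 _] eps n /RltP e0 /RleP eps_le _.
rewrite !RminE !le_min in eps_le; case/and3P: eps_le => e12 thr1 thr2.
apply/RleP; rewrite !chain_termsE RplusE RmultE -big_split /= IZR4.
by apply: (main_bound z0 tP1 tP2 irr1 irr2 iP1 iP2 dnu1 dnu2 mu0 Q1 tails) => //;
  rewrite div1r -?IZR2 -?IZR4 -?RinvE.
Qed.
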